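(* The model checking problem of $\mathrm{LTL}(\sim)$ is logspace-reducible to $\mathbf{\Delta^3_0}$.
   Context: Let $\mathrm{AP}$ be a countably infinite set of atomic propositions. A trace is an infinite sequence $t=t(0)t(1)\cdots\in(\wp\mathrm{AP})^\omega$, and $t^i=t(i)t(i+1)\cdots$. A team is a (possibly empty) set $T$ of traces, and $T^i=\{t^i: t\in T\}$. Formulas of $\mathrm{LTL}(\sim)$ are given by $\varphi::=p\mid\neg\varphi\mid\varphi\wedge\varphi\mid\varphi\vee\varphi\mid\mathsf X\varphi\mid\mathsf F\varphi\mid\mathsf G\varphi\mid\varphi\,\mathsf U\,\varphi\mid\varphi\,\mathsf R\,\varphi\mid{\sim}\varphi$ with $p\in\mathrm{AP}$. Synchronous team semantics: $T\models p$ iff $p\in t(0)$ for all $t\in T$; $T\models\neg\varphi$ iff $\{t\}\not\models\varphi$ for all $t\in T$; $T\models\varphi\wedge\psi$ iff $T\models\varphi$ and $T\models\psi$; $T\models\varphi\vee\psi$ iff $T=S\cup U$ for some $S,U$ with $S\models\varphi$ and $U\models\psi$; $T\models\mathsf X\varphi$ iff $T^1\models\varphi$; $T\models\mathsf F\varphi$ iff $T^k\models\varphi$ for some $k\ge0$; $T\models\mathsf G\varphi$ iff $T^k\models\varphi$ for all $k\ge0$; $T\models\varphi\,\mathsf U\,\psi$ iff there is $k\ge0$ with $T^k\models\psi$ and $T^j\models\varphi$ for all $j<k$; $T\models\varphi\,\mathsf R\,\psi$ iff for all $k\ge0$, $T^k\models\psi$ or $T^j\models\varphi$ for some $j<k$;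 $T\models{\sim}\varphi$ iff $T\not\models\varphi$. A finite Kripke structure is $K=(W,R,\eta,r)$ with $W$ finite nonempty, $R\subseteq W\times W$ serial, $\eta:W\to\wp\mathrm{AP}$ with finite labels, and root $r\in W$; a path is $\pi\in W^\omega$ with $\pi(0)=r$ and $(\pi(i),\pi(i+1))\in R$; it induces the trace $(\eta(\pi(i)))_{i\ge0}$; $T(K)$ is the team of all induced traces. Model checking: the set of pairs $(K,\varphi)$, $K$ a finite Kripke structure (encoded in binary), with $T(K)\models\varphi$. $\mathbf{\Delta^3_0}$ denotes the set of closed formulas of third-order arithmetic (vocabulary $+,\times,0,1,=,\le$; first-order variables range over $\mathbb N$, second-order variables of arity $n$ over subsets of $\mathbb N^n$, third-order variables of type $(n_1,\dots,n_k)$ over subsets of $\wp(\mathbb N^{n_1})\times\cdots\times\wp(\mathbb N^{n_k})$, with atoms $\mathfrak a(A_1,\dots,A_k)$) that are true in the standard model $\mathbb N$. *)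

(* Defs.v *)
From mathcomp Require Import all_boot.
From Stdlib Require NArith.
Set Implicit Arguments. Unset Strict Implicit. Unset Printing Implicit Defensive.

Inductive tok :=
  | t0 | t1 | tsep | tlp | trp
  | tAtom | tNeg | tAnd | tOr | tX | tF | tG | tU | tR | tSim
  | tV | tZero | tOne | tPlus | tTimes | tEq | tLe | tSO | tTO
  | tE1 | tA1 | tE2 | tA2 | tE3 | tA3.

Fixpoint pos_bits (p : BinNums.positive) : seq tok :=
  match p with
  | BinNums.xH => [:: t1]
  | BinNums.xO q => pos_bits q ++ [:: t0]
  | BinNums.xI q => pos_bits q ++ [:: t1]
  end.
Definition bin (n : nat) : seq tok :=
  match BinNat.N.of_nat n with BinNums.N0 => [:: t0] | BinNums.Npos p => pos_bits p end.
Definition binsep (n : nat) : seq tok := bin n ++ [:: tsep].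

Inductive ltl :=
  | LAtom (p : nat) | LNeg (f : ltl) | LAnd (f g : ltl) | LOr (f g : ltl)
  | LX (f : ltl) | LF (f : ltl) | LG (f : ltl) | LU (f g : ltl) | LR (f g : ltl)
  | LSim (f : ltl).

(* a trace t : (P AP)^omega ; t i p  <->  p \in t(i) *)
Definition trace := nat -> nat -> bool.
Definition team := trace -> Prop.

Definition shiftT (k : nat) (T : team) : team :=
  fun s => exists t, T t /\ s = (fun i => t (k + i)).

Fixpoint tsat (T : team) (f : ltl) : Prop :=
  match f with
  | LAtom p => forall t, T t -> t 0 p
  | LNeg g => forall t, T t -> ~ tsat (fun s => s = t) g
  | LAnd g h => tsat T g /\ tsat T h
  | LOr g h => exists S U : team,
      (forall t, T t <-> S t \/ U t) /\ tsat S g /\ tsat U h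
  | LX g => tsat (shiftT 1 T) g
  | LF g => exists k, tsat (shiftT k T) g
  | LG g => forall k, tsat (shiftT k T) g
  | LU g h => exists k, tsat (shiftT k T) h /\
                        forall j, j < k -> tsat (shiftT j T) g
  | LR g h => forall k, tsat (shiftT k T) h \/
                        exists j, j < k /\ tsat (shiftT j T) g
  | LSim g => ~ tsat T g
  end.

(* Finite Kripke structures: W = {0,..,kn-1}, R as adjacency matrix,
   eta as a (finite) list of atomic propositions per world, root. *)
Record KS := { kn : nat; kR : seq (seq bool); klab : seq (seq nat); kroot : nat }.

Definition kedge (K : KS) (w v : nat) : bool := nth false (nth [::] (kR K) w) v.
Definition klabel (K : KS) (w : nat) : seq nat := nth [::] (klab K) w.

Definition wfKS (K : KS) : Prop :=
  0 < kn K /\ size (kR K) = kn K /\ (forall row, row \in kR K -> size row = kn K)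
  /\ size (klab K) = kn K /\ kroot K < kn K
  /\ (forall w, w < kn K -> exists v, v < kn K /\ kedge K w v).

Definition teamK (K : KS) : team :=
  fun t => exists pi : nat -> nat,
    pi 0 = kroot K /\ (forall i, pi i < kn K) /\ (forall i, kedge K (pi i) (pi i.+1))
    /\ t = (fun i p => p \in klabel K (pi i)).

Fixpoint enc_ltl (f : ltl) : seq tok :=
  match f with
  | LAtom p => tAtom :: binsep p
  | LNeg g => tNeg :: enc_ltl g
  | LAnd g h => tAnd :: enc_ltl g ++ enc_ltl h
  | LOr g h => tOr :: enc_ltl g ++ enc_ltl h
  | LX g => tX :: enc_ltl g
  | LF g => tF :: enc_ltl g
  | LG g => tG :: enc_ltl g
  | LU g h => tU :: enc_ltl g ++ enc_ltl h
  | LR g h => tR :: enc_ltl g ++ enc_ltl h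
  | LSim g => tSim :: enc_ltl g
  end.

Definition enc_bit (b : bool) : tok := if b then t1 else t0.

Definition enc_KS (K : KS) : seq tok :=
  binsep (kn K) ++ binsep (kroot K)
  ++ flatten [seq map enc_bit row ++ [:: tsep] | row <- kR K]
  ++ flatten [seq flatten (map binsep l) ++ [:: trp] | l <- klab K].

Definition enc_MC (K : KS) (f : ltl) : seq tok := enc_KS K ++ tlp :: enc_ltl f.

Definition MC_lang : seq tok -> Prop :=
  fun w => exists K f, w = enc_MC K f /\ wfKS K /\ tsat (teamK K) f.

Inductive aterm :=
  | AVar (i : nat) | AZero | AOne | APlus (a b : aterm) | ATimes (a b : aterm).

(* second-order variables are pairs (index, arity);
   third-order variables are pairs (index, type (n1,...,nk)) *)
Inductive tform :=
  | FEq (a b : aterm) | FLe (a b : aterm)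
  | FSO (i n : nat) (ts : seq aterm)
  | FTO (j : nat) (ty : seq nat) (args : seq (nat * nat))
  | FNot (f : tform) | FAnd (f g : tform) | FOr (f g : tform)
  | FEx1 (i : nat) (f : tform) | FAll1 (i : nat) (f : tform)
  | FEx2 (i n : nat) (f : tform) | FAll2 (i n : nat) (f : tform)
  | FEx3 (j : nat) (ty : seq nat) (f : tform) | FAll3 (j : nat) (ty : seq nat) (f : tform).

Fixpoint aeval (e1 : nat -> nat) (a : aterm) : nat :=
  match a with
  | AVar i => e1 i | AZero => 0 | AOne => 1
  | APlus a b => aeval e1 a + aeval e1 b
  | ATimes a b => aeval e1 a * aeval e1 b
  end.

Fixpoint avars (a : aterm) : seq nat :=
  match a with
  | AVar i => [:: i] | AZero | AOne => [::]
  | APlus a b | ATimes a b => avars a ++ avars b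
  end.

Fixpoint wt (f : tform) : bool :=
  match f with
  | FEq _ _ | FLe _ _ => true
  | FSO _ n ts => size ts == n
  | FTO _ ty args => map snd args == ty
  | FNot g | FEx1 _ g | FAll1 _ g | FEx2 _ _ g | FAll2 _ _ g
  | FEx3 _ _ g | FAll3 _ _ g => wt g
  | FAnd g h | FOr g h => wt g && wt h
  end.

Fixpoint closed_in (b1 : seq nat) (b2 : seq (nat * nat)) (b3 : seq (nat * seq nat))
    (f : tform) : bool :=
  match f with
  | FEq a b | FLe a b => all (fun i => i \in b1) (avars a ++ avars b)
  | FSO i n ts => ((i, n) \in b2) && all (fun i => i \in b1) (flatten (map avars ts))
  | FTO j ty args => ((j, ty) \in b3) && all (fun x => x \in b2) args
  | FNot g => closed_in b1 b2 b3 g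
  | FAnd g h | FOr g h => closed_in b1 b2 b3 g && closed_in b1 b2 b3 h
  | FEx1 i g | FAll1 i g => closed_in (i :: b1) b2 b3 g
  | FEx2 i n g | FAll2 i n g => closed_in b1 ((i, n) :: b2) b3 g
  | FEx3 j ty g | FAll3 j ty g => closed_in b1 b2 ((j, ty) :: b3) g
  end.

Definition env1 := nat -> nat.
(* value of second-order variable (i, n): a subset of N^n, as a predicate on lists *)
Definition env2 := nat -> nat -> (seq nat -> Prop).
Definition env3 := nat -> seq nat -> (seq (seq nat -> Prop) -> Prop).

Definition upd1 (e : env1) i v : env1 := fun i' => if i' == i then v else e i'.
Definition upd2 (e : env2) i n (P : seq nat -> Prop) : env2 :=
  fun i' n' => if (i' == i) && (n' == n) then P else e i' n'.
Definition upd3 (e : env3) j ty (A : seq (seq nat -> Prop) -> Prop) : env3 :=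
  fun j' ty' => if (j' == j) && (ty' == ty) then A else e j' ty'.

Definition arityOK (n : nat) (P : seq nat -> Prop) : Prop :=
  forall l, P l -> size l = n.

Fixpoint tsat3 (e1 : env1) (e2 : env2) (e3 : env3) (f : tform) : Prop :=
  match f with
  | FEq a b => aeval e1 a = aeval e1 b
  | FLe a b => aeval e1 a <= aeval e1 b
  | FSO i n ts => e2 i n (map (aeval e1) ts)
  | FTO j ty args => e3 j ty (map (fun x => e2 x.1 x.2) args)
  | FNot g => ~ tsat3 e1 e2 e3 g
  | FAnd g h => tsat3 e1 e2 e3 g /\ tsat3 e1 e2 e3 h
  | FOr g h => tsat3 e1 e2 e3 g \/ tsat3 e1 e2 e3 h
  | FEx1 i g => exists v, tsat3 (upd1 e1 i v) e2 e3 g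
  | FAll1 i g => forall v, tsat3 (upd1 e1 i v) e2 e3 g
  | FEx2 i n g => exists P, arityOK n P /\ tsat3 e1 (upd2 e2 i n P) e3 g
  | FAll2 i n g => forall P, arityOK n P -> tsat3 e1 (upd2 e2 i n P) e3 g
  | FEx3 j ty g => exists A, tsat3 e1 e2 (upd3 e3 j ty A) g
  | FAll3 j ty g => forall A, tsat3 e1 e2 (upd3 e3 j ty A) g
  end.

Definition Delta30 (f : tform) : Prop :=
  closed_in [::] [::] [::] f /\ wt f /\
  tsat3 (fun _ => 0) (fun _ _ _ => False) (fun _ _ _ => False) f.

Fixpoint enc_aterm (a : aterm) : seq tok :=
  match a with
  | AVar i => tV :: binsep i
  | AZero => [:: tZero] | AOne => [:: tOne]
  | APlus a b => tPlus :: enc_aterm a ++ enc_aterm b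
  | ATimes a b => tTimes :: enc_aterm a ++ enc_aterm b
  end.

Definition enc_natlist (l : seq nat) : seq tok := flatten (map binsep l) ++ [:: trp].

Fixpoint enc_tform (f : tform) : seq tok :=
  match f with
  | FEq a b => tEq :: enc_aterm a ++ enc_aterm b
  | FLe a b => tLe :: enc_aterm a ++ enc_aterm b
  | FSO i n ts => tSO :: binsep i ++ binsep n ++ flatten (map enc_aterm ts) ++ [:: trp]
  | FTO j ty args => tTO :: binsep j ++ enc_natlist ty
                     ++ flatten [seq binsep x.1 ++ binsep x.2 | x <- args] ++ [:: trp]
  | FNot g => tNeg :: enc_tform g
  | FAnd g h => tAnd :: enc_tform g ++ enc_tform h
  | FOr g h => tOr :: enc_tform g ++ enc_tform h
  | FEx1 i g => tE1 :: binsep i ++ enc_tform g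
  | FAll1 i g => tA1 :: binsep i ++ enc_tform g
  | FEx2 i n g => tE2 :: binsep i ++ binsep n ++ enc_tform g
  | FAll2 i n g => tA2 :: binsep i ++ binsep n ++ enc_tform g
  | FEx3 j ty g => tE3 :: binsep j ++ enc_natlist ty ++ enc_tform g
  | FAll3 j ty g => tA3 :: binsep j ++ enc_natlist ty ++ enc_tform g
  end.

Definition Delta30_lang : seq tok -> Prop :=
  fun w => exists f, w = enc_tform f /\ Delta30 f.

(* Deterministic Turing machine with a two-way read-only input tape
   (with end-markers), one work tape (left-bounded), and a one-way
   write-only output tape. *)
Inductive move := MLeft | MStay | MRight.
Inductive inp (A : Type) := LEnd | ISym (a : A) | REnd.
Arguments LEnd {A}. Arguments REnd {A}.

Record LTM (A B : Type) := {
  lstate : finType;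
  lwork : finType;
  lblank : lwork;
  lstart : lstate;
  lhalt : lstate -> bool;
  ldelta : lstate -> inp A -> lwork ->
           lstate * lwork * move * move * option B
}.

Arguments lblank {A B} l.
Arguments lstart {A B} l.
Arguments lhalt {A B} l _.
Arguments ldelta {A B} l _ _ _.

Record config (Q G B : Type) := Config {
  cq : Q; cin : nat; ctape : nat -> G; cwork : nat; cout : seq B }.

Section Run.
Variables (A B : Type) (M : LTM A B) (w : seq A).

(* input position 0 is the left end-marker, positions 1..|w| the input
   symbols, |w|+1 the right end-marker; the input head stays in [0, |w|+1] *)
Definition read_in (i : nat) : inp A :=
  if i is i'.+1 then (if drop i' w is a :: _ then ISym a else REnd) else LEnd.

Definition move_in (i : nat) (m : move) : nat :=
  match m with
  | MLeft => i.-1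
  | MStay => i
  | MRight => minn i.+1 (size w).+1
  end.

Definition move_work (j : nat) (m : move) : nat :=
  match m with MLeft => j.-1 | MStay => j | MRight => j.+1 end.

Definition cfg := config (lstate M) (lwork M) B.

Definition init_cfg : cfg := Config (lstart M) 0 (fun _ => lblank M) 0 [::].

Definition step (c : cfg) : cfg :=
  if lhalt M (cq c) then c else
  let '(q', g, mi, mw, o) := ldelta M (cq c) (read_in (cin c)) (ctape c (cwork c)) in
  Config q' (move_in (cin c) mi)
         (fun k => if k == cwork c then g else ctape c k)
         (move_work (cwork c) mw)
         (cout c ++ (if o is Some b then [:: b] else [::])).

Definition run (n : nat) : cfg := iter n step init_cfg.
End Run.

Definition ltm_computes (A B : Type) (M : LTM A B) (w : seq A) (o : seq B) : Prop :=
  exists n, lhalt M (cq (run M w n)) /\ cout (run M w n) = o.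

Definition logspace (A B : Type) (M : LTM A B) : Prop :=
  (forall w, exists n, lhalt M (cq (run M w n))) /\
  exists c, forall w n, cwork (run M w n) <= c * (Nat.log2 (size w) + 1).

Definition logspace_reducible (A B : Type) (L1 : seq A -> Prop) (L2 : seq B -> Prop) : Prop :=
  exists M : LTM A B, logspace M /\
    forall w o, ltm_computes M w o -> (L1 w <-> L2 o).

(* Main.v *)
From HB Require Import structures.
Require Import Defs.
From mathcomp Require Import all_boot.
From mathcomp Require Import boolp zify.
From Stdlib Require PArith NArith ZArith.
Set Implicit Arguments. Unset Strict Implicit. Unset Printing Implicit Defensive.

(** In Polish notation the reduction is computable by a finite transducer that
    makes a single pass and uses no work tape at all.

    A team is a third-order object, so T |= f is translated by recursion on f into a
    formula about a third-order variable.  Reusing variable names, the translation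
    of each connective is a fixed word that precedes the translations of its
    operands.  The tokens of the Kripke structure and the digits of atom indices
    are translated in continuation style: each one becomes a chain of existential
    quantifiers and conjuncts stating that some new state results from the old one by
    reading this token.  The syntactic conditions on the structure
    that are not regular are thus checked by the output formula itself.

    Conversely the encoding of formulas is uniquely parsable, and an input with a
    formula part of bad syntax has an output that encodes no formula. *)

(** * One-pass transducers *)

(** A finite transducer sees a binary connective but cannot tell where its first operand ends, which
    would take a stack. Hence all that concerns either operand is written in front of the first one,
    and only contexts whose holes come last can be produced. In Polish notation these are prefix
    words, and no closing token is ever due.

    The chains of existential quantifiers keep their meaning under negation because each token acts
    on the state as a partial function: the quantified values are determined by the earlier ones.
    Truth of a chain yields a run, and a run yields truth of the chain; the two directions of the
    reduction use one half each.

    The control keeps only finite information on a numeral (no digit yet, the numeral 0, a positive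
    one), enough to reject leading zeros; the value itself is computed by the formula. Values are
    stored shifted by one, so that 0 means that no digit has been read. *)

Section Transducer.
Variables (A B : Type) (Q : finType) (q0 : Q) (pre : seq B).
Variables (nxt : Q -> A -> Q) (out : Q -> A -> seq B) (L : nat).

Fixpoint trans (q : Q) (w : seq A) : seq B :=
  if w is a :: w' then out q a ++ trans (nxt q a) w' else [::].

Definition pending (q : Q) (rd : inp A) : seq B :=
  match rd with LEnd => pre | ISym a => out q a | REnd => [::] end.

(** One letter is written per step, so [k] counts the letters of the current word already written;
    the input head moves when none is left. [None] is the halting state. The prefix [pre] is the
    word attached to the left end-marker. *)
Definition tr_delta (s : option (Q * 'I_L.+1)) (rd : inp A) (_ : unit) :
    option (Q * 'I_L.+1) * unit * move * move * option B :=
  if s is Some (q, k) then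
    if onth (pending q rd) k is Some b
    then (Some (q, inord k.+1), tt, MStay, MStay, Some b)
    else match rd with
         | LEnd => (Some (q, ord0), tt, MRight, MStay, None)
         | ISym a => (Some (nxt q a, ord0), tt, MRight, MStay, None)
         | REnd => (None, tt, MStay, MStay, None)
         end
  else (None, tt, MStay, MStay, None).

Definition transducer : LTM A B :=
  @Build_LTM A B _ _ tt (Some (q0, ord0)) (fun s => s == None) tr_delta.

Hypothesis size_pre : size pre <= L.
Hypothesis size_out : forall q a, size (out q a) <= L.

Definition tcfg (s : option (Q * 'I_L.+1)) (i : nat) (o : seq B) :
  cfg transducer := @Config (lstate transducer) (lwork transducer) B s i (fun _ => tt) 0 o.

(** Overwriting a cell gives a syntactically different tape, but all functions into [unit] are
    equal, so every configuration returns to the form [tcfg]. *)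
Lemma tcfgE s i (f : nat -> unit) o :
  @Config (lstate transducer) (lwork transducer) B s i f 0 o = tcfg s i o.
Proof. by congr Config; apply/funext=> z; case: (f z). Qed.

Lemma transducer_emit w q i (k : 'I_L.+1) o :
  exists n k', onth (pending q (read_in w i)) (k' : 'I_L.+1) = None /\
    iter n (step w) (tcfg (Some (q, k)) i o)
    = tcfg (Some (q, k')) i (o ++ drop k (pending q (read_in w i))).
Proof.
have size_p : size (pending q (read_in w i)) <= L by case: (read_in w i) => //=.
move: {2}(L - k) (erefl (L - k)) => m; elim: m k o => [|m IHm] k o Em.
  have ge_k : size (pending q (read_in w i)) <= k.
    by apply: leq_trans size_p _; rewrite -subn_eq0 Em.
  exists 0, k; rewrite drop_oversize // cats0; split=> //.
  exact: onth_default.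
case E: (onth (pending q (read_in w i)) k) => [b|]; last first.
  exists 0, k; split=> //; rewrite drop_oversize ?cats0 //.
  by rewrite -onthNE E.
have lt_k : k < size (pending q (read_in w i)).
  by rewrite -onthTE E.
(* A letter at position [k] forces [k < L], so [inord] does not fall back to its default value. *)
have lt_kL : k.+1 < L.+1 by rewrite ltnS (leq_trans lt_k).
have Ek : nat_of_ord (inord k.+1 : 'I_L.+1) = k.+1 by rewrite inordK.
have [|n [k' [Ek' En]]] := IHm (inord k.+1) (o ++ [:: b]).
  by rewrite Ek subnS Em.
exists n.+1, k'; split=> //.
rewrite iterSr {2}/step /= /tr_delta E.
rewrite tcfgE [LHS]En Ek -catA /=; congr (tcfg _ _ (_ ++ _)).
by rewrite (drop_nth b lt_k) (onth_nth b b _ _ E).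
Qed.

Lemma transducer_move w q i o :
  exists n, iter n (step w) (tcfg (Some (q, ord0)) i o)
    = match read_in w i with
      | LEnd => tcfg (Some (q, ord0)) (minn i.+1 (size w).+1) (o ++ pre)
      | ISym a => tcfg (Some (nxt q a, ord0)) (minn i.+1 (size w).+1) (o ++ out q a)
      | REnd => tcfg None i o
      end.
Proof.
have [n [k [Ek En]]] := transducer_emit w q i ord0 o.
exists n.+1; rewrite iterS En drop0 {En} /step /= /tr_delta Ek.
by case: (read_in w i) => [|a|] /=; rewrite tcfgE !cats0.
Qed.

Lemma transducer_scan w q u v o : w = u ++ v ->
  exists n, iter n (step w) (tcfg (Some (q, ord0)) (size u).+1 o)
    = tcfg None (size w).+1 (o ++ trans q v).
Proof.
elim: v u q o => [|a v IHv] u q o Ew.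
  have [n En] := transducer_move w q (size u).+1 o.
  exists n; rewrite En /= Ew cats0 drop_size /=.
  by rewrite cats0.
have [n En] := transducer_move w q (size u).+1 o.
rewrite /= {2}Ew drop_size_cat // in En.
have [|m Em] := IHv (rcons u a) (nxt q a) (o ++ out q a).
  by rewrite Ew cat_rcons.
exists (m + n); rewrite iterD En.
have -> : minn (size u).+2 (size w).+1 = (size (rcons u a)).+1.
  rewrite Ew size_cat /= size_rcons; lia.
by rewrite Em catA.
Qed.

Lemma transducer_run w :
  exists n, run transducer w n = tcfg None (size w).+1 (pre ++ trans q0 w).
Proof.
have [n En] := transducer_move w q0 0 [::].
have [m Em] := transducer_scan q0 pre (erefl ([::] ++ w)).
exists (m + n); rewrite /run iterD.
have -> : init_cfg transducer = tcfg (Some (q0, ord0)) 0 [::] by [].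
by rewrite En /= -Em minnSS min0n.
Qed.

Lemma run_halted (M : LTM A B) w n m :
  lhalt M (cq (run M w n)) -> run M w (m + n) = run M w n.
Proof.
move=> Hn; elim: m => [//|m IHm].
by rewrite addSn {1}/run iterS -/(run M w (m + n)) IHm /step Hn.
Qed.

(** A reduction has to be right for every output that the machine computes; a halted run no longer
    changes, so there is at most one. *)
Lemma ltm_computes_fun (M : LTM A B) w o o' :
  ltm_computes M w o -> ltm_computes M w o' -> o = o'.
Proof.
move=> [n [Hn <-]] [m [Hm <-]].
by rewrite -(run_halted m Hn) addnC (run_halted n Hm).
Qed.

Lemma transducer_computes w : ltm_computes transducer w (pre ++ trans q0 w).
Proof. by have [n En] := transducer_run w; exists n; rewrite En. Qed.

Lemma transducer_logspace : logspace transducer.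
Proof.
split=> [w|]; first by have [n En] := transducer_run w; exists n; rewrite En.
(* The work head never moves, so the space bound holds with constant 0. *)
exists 0 => w n; rewrite mul0n leqn0.
elim: n => [//|n]; rewrite /run iterS -/(run transducer w n) /step /=.
case: (cq _) => [[q k]|] //= /eqP E0; rewrite /tr_delta.
case: (onth _ _) => [b|] /=; first by rewrite E0.
by case: (read_in _ _) => [|a|] /=; rewrite E0.
Qed.

End Transducer.

(** * Binary numerals and unique parsing *)

Definition is_digit (t : tok) : bool := if t is (t0 | t1) then true else false.
Definition bits (n : nat) : seq bool := [seq (if t is t1 then true else false) | t <- bin n].

(* Reads binary digits, most significant first, shifting the value by one:
   0 = nothing read yet, x.+1 = a numeral of value x.  Leading zeros are
   rejected, as [bin] never produces them. *)
Definition bstep (x : nat) (b : bool) : option nat :=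
  match x with
  | 0 => Some b.+1
  | 1 => None
  | _ => Some (x.*2.-1 + b)
  end.
Definition bfold (x : nat) (bs : seq bool) : option nat :=
  foldl (fun o b => obind (bstep^~ b) o) (Some x) bs.

Lemma bfold_rcons x bs b : bfold x (rcons bs b) = obind (bstep^~ b) (bfold x bs).
Proof. by rewrite /bfold -cats1 foldl_cat. Qed.

Lemma foldl_obind_None bs : foldl (fun o b => obind (bstep^~ b) o) None bs = None.
Proof. by elim: bs. Qed.

Lemma bfold_cons x b bs :
  bfold x (b :: bs) = obind (fun y => bfold y bs) (bstep x b).
Proof. by rewrite /bfold /=; case: (bstep x b) => //=; rewrite foldl_obind_None. Qed.

Lemma digits_pos p : all is_digit (pos_bits p).
Proof. by elim: p => //= p IHp; rewrite all_cat IHp. Qed.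

Lemma digits_bin n : all is_digit (bin n).
Proof. by rewrite /bin; case: BinNat.N.of_nat => // p; apply: digits_pos. Qed.

Lemma map_enc_bit s : all is_digit s ->
  map enc_bit [seq (if t is t1 then true else false) | t <- s] = s.
Proof. by elim: s => //= -[] //= s IHs /IHs->. Qed.

Lemma enc_bits n : map enc_bit (bits n) = bin n.
Proof. exact/map_enc_bit/digits_bin. Qed.

Section Numerals.
Import PArith NArith.

Lemma bfold_pos p :
  bfold 0 [seq (if t is t1 then true else false) | t <- pos_bits p]
  = Some (Pos.to_nat p).+1.
Proof.
have gt0 := Pos2Nat.is_pos.
elim: p => [p IHp|p IHp|] //=; rewrite map_cat cats1 bfold_rcons IHp /=
  ?Pos2Nat.inj_xO ?Pos2Nat.inj_xI; move: (gt0 p);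
  by case: (Pos.to_nat p) => [|m] /= ?; first lia; congr Some; lia.
Qed.

Lemma bfold_bits n : bfold 0 (bits n) = Some n.+1.
Proof.
rewrite /bits /bin; case E: (BinNat.N.of_nat n) => [|p] /=.
  by have := f_equal N.to_nat E; rewrite Nat2N.id /= => ->.
by rewrite bfold_pos; have := f_equal N.to_nat E; rewrite Nat2N.id /= => ->.
Qed.

(** This fails for [m = 0]: the numeral of 0 has a digit of its own, which would become a leading
    zero. *)
Lemma bits_double m (b : bool) : 0 < m -> bits (b + m.*2) = rcons (bits m) b.
Proof.
move=> m_gt0; pose p := Pos.of_nat m.
have -> : m = Pos.to_nat p by rewrite Nat2Pos.id; lia.
rewrite /bits /bin Znat.positive_nat_N.
have -> : b + (Pos.to_nat p).*2 = Pos.to_nat (if b then xI p else xO p).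
  by case: b; rewrite ?Pos2Nat.inj_xO ?Pos2Nat.inj_xI; lia.
by rewrite Znat.positive_nat_N; case: b; rewrite /= map_cat cats1.
Qed.

End Numerals.

Lemma bfold_eq0 bs : bfold 0 bs = Some 0 -> bs = [::].
Proof.
case/lastP: bs => // bs b; rewrite bfold_rcons.
by case: (bfold 0 bs) => [[|[|y]]|] //= [].
Qed.

(** As leading zeros are rejected, an accepted digit word is the canonical numeral of its value. The
    induction is from the right, where [bstep] appends the least significant digit. *)
Lemma bfold_inv bs x : bfold 0 bs = Some x.+1 -> bs = bits x.
Proof.
elim/last_ind: bs x => [//|bs b IHbs] x; rewrite bfold_rcons.
case E: (bfold 0 bs) => [[|[|y]]|] //= [].
  by rewrite (bfold_eq0 E) => <-; case: b.
by move=> <-; rewrite (IHbs _ E) -bits_double //; congr bits; lia.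
Qed.

Lemma bin_inj n m : bin n = bin m -> n = m.
Proof.
move=> E; have : bfold 0 (bits n) = bfold 0 (bits m) by rewrite /bits E.
by rewrite !bfold_bits => -[].
Qed.

Lemma bits_cons n : exists b bs, bits n = b :: bs.
Proof.
by have := bfold_bits n; case E: (bits n) => [|b bs] //; exists b, bs.
Qed.

Lemma bin_sep_inj n m s s' :
  bin n ++ [:: tsep] ++ s = bin m ++ [:: tsep] ++ s' -> n = m /\ s = s'.
Proof.
move=> E.
suff [Eb ->] : bin n = bin m /\ s = s' by rewrite (bin_inj Eb).
elim: (bin n) (bin m) (digits_bin n) (digits_bin m) E => [|a u IHu] [|b v] //=.
- by move=> _ _ [].
- by case: b.
- by case: a.
by move=> /andP[_ Du] /andP[_ Dv] [-> /(IHu _ Du Dv)[-> ->]].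
Qed.

Lemma binsep_cons n : exists t u, binsep n = t :: u /\ is_digit t.
Proof.
rewrite /binsep -enc_bits; have [b [bs ->]] := bits_cons n.
by exists (enc_bit b), (map enc_bit bs ++ [:: tsep]); case: b.
Qed.

Lemma natlist_inj l l' s s' :
  flatten (map binsep l) ++ [:: trp] ++ s = flatten (map binsep l') ++ [:: trp] ++ s' ->
  l = l' /\ s = s'.
Proof.
elim: l l' => [|n l IHl] [|m l'] /=.
- by move=> [->].
- by have [[] [u [-> ?]]] := binsep_cons m.
- by have [[] [u [-> ?]]] := binsep_cons n.
by rewrite -!catA => /bin_sep_inj[-> /IHl[-> ->]].
Qed.

Lemma enc_aterm_inj a b s s' :
  enc_aterm a ++ s = enc_aterm b ++ s' -> a = b /\ s = s'.
Proof.
elim: a b s s' => [i|||a1 IH1 a2 IH2|a1 IH1 a2 IH2] [j|||b1 b2|b1 b2] s s' //=.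
- by rewrite -!catA => -[/bin_sep_inj[-> ->]].
- by move=> [->].
- by move=> [->].
- by rewrite -!catA => -[/IH1[-> /IH2[-> ->]]].
- by rewrite -!catA => -[/IH1[-> /IH2[-> ->]]].
Qed.

Lemma enc_terms_inj ts ts' s s' :
  flatten (map enc_aterm ts) ++ trp :: s = flatten (map enc_aterm ts') ++ trp :: s' ->
  ts = ts' /\ s = s'.
Proof.
elim: ts ts' => [|a ts IHts] [|b ts'] /=; rewrite -?catA.
- by move=> [->].
- by case: b.
- by case: a.
by move=> /enc_aterm_inj[-> /IHts[-> ->]].
Qed.

Lemma enc_args_inj (l l' : seq (nat * nat)) s s' :
  flatten [seq binsep x.1 ++ binsep x.2 | x <- l] ++ trp :: s
  = flatten [seq binsep x.1 ++ binsep x.2 | x <- l'] ++ trp :: s' ->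
  l = l' /\ s = s'.
Proof.
elim: l l' => [|[n m] l IHl] [|[n' m'] l'] /=.
- by move=> [->].
- by have [[] [u [-> ?]]] := binsep_cons n'.
- by have [[] [u [-> ?]]] := binsep_cons n.
by rewrite -!catA => /bin_sep_inj[-> /bin_sep_inj[-> /IHl[-> ->]]].
Qed.

(** The first token names the constructor and every part delimits itself, so encodings form a prefix
    code. The arbitrary tails carry this through consecutive parts. *)
Lemma enc_tform_inj F G s s' :
  enc_tform F ++ s = enc_tform G ++ s' -> F = G /\ s = s'.
Proof.
elim: F G s s' => [a b|a b|i n ts|j ty l|F IHF|F IHF F' IHF'|F IHF F' IHF'
  |i F IHF|i F IHF|i n F IHF|i n F IHF|j ty F IHF|j ty F IHF];
case=> [c d|c d|k m us|k uy m|G|G G'|G G'|k G|k G|k m G|k m G|k uy G|k uy G] s s' //=;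
rewrite -?catA => -[].
- by move=> /enc_aterm_inj[-> /enc_aterm_inj[-> ->]].
- by move=> /enc_aterm_inj[-> /enc_aterm_inj[-> ->]].
- by move=> /bin_sep_inj[-> /bin_sep_inj[-> /enc_terms_inj[-> ->]]].
- by move=> /bin_sep_inj[-> /natlist_inj[-> /enc_args_inj[-> ->]]].
- by move=> /IHF[-> ->].
- by move=> /IHF[-> /IHF'[-> ->]].
- by move=> /IHF[-> /IHF'[-> ->]].
- by move=> /bin_sep_inj[-> /IHF[-> ->]].
- by move=> /bin_sep_inj[-> /IHF[-> ->]].
- by move=> /bin_sep_inj[-> /bin_sep_inj[-> /IHF[-> ->]]].
- by move=> /bin_sep_inj[-> /bin_sep_inj[-> /IHF[-> ->]]].
- by move=> /bin_sep_inj[-> /natlist_inj[-> /IHF[-> ->]]].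
- by move=> /bin_sep_inj[-> /natlist_inj[-> /IHF[-> ->]]].
Qed.

(** * Contexts with the hole at the end, and their words *)

Inductive frame :=
  | KE1 (i : nat) | KA1 (i : nat) | KE2 (i n : nat) | KA2 (i n : nat)
  | KE3 (j : nat) (ty : seq nat) | KNot | KAnd (F : tform) | KOr (F : tform).

Definition plug1 (c : frame) (G : tform) : tform :=
  match c with
  | KE1 i => FEx1 i G | KA1 i => FAll1 i G
  | KE2 i n => FEx2 i n G | KA2 i n => FAll2 i n G
  | KE3 j ty => FEx3 j ty G
  | KNot => FNot G | KAnd F => FAnd F G | KOr F => FOr F G
  end.
Definition plug (c : seq frame) (G : tform) : tform := foldr plug1 G c.

Definition enc_frame (c : frame) : seq tok :=
  match c with
  | KE1 i => tE1 :: binsep i | KA1 i => tA1 :: binsep i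
  | KE2 i n => tE2 :: binsep i ++ binsep n
  | KA2 i n => tA2 :: binsep i ++ binsep n
  | KE3 j ty => tE3 :: binsep j ++ enc_natlist ty
  | KNot => [:: tNeg]
  | KAnd F => tAnd :: enc_tform F
  | KOr F => tOr :: enc_tform F
  end.
Definition enc_ctx (c : seq frame) : seq tok := flatten (map enc_frame c).

Lemma enc_plug c G : enc_tform (plug c G) = enc_ctx c ++ enc_tform G.
Proof.
elim: c => //= a c IHc; rewrite /enc_ctx /= -catA -/(enc_ctx c) -IHc.
by case: a => *; rewrite /= -?catA.
Qed.

(** The converse of [enc_plug], by unique parsing: a formula whose encoding starts with the word of
    a context is built with that context, whatever comes after. *)
Lemma parse_plug c s F r : enc_ctx c ++ s = enc_tform F ++ r ->
  exists2 G, F = plug c G & s = enc_tform G ++ r.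
Proof.
elim: c F => [|a c IHc] F /=; first by exists F.
rewrite /enc_ctx /= -catA -/(enc_ctx c) => E.
suff [G -> /IHc[H -> ->]] : exists2 G, F = plug1 a G & enc_ctx c ++ s = enc_tform G ++ r.
  by exists H.
case: a F E => [i|i|i n|i n|j ty||H|H];
case=> [x y|x y|k m us|k uy m|G|G G'|G G'|k G|k G|k m G|k m G|k uy G|k uy G] //=;
rewrite -?catA => -[].
- by move=> /bin_sep_inj[-> ->]; exists G.
- by move=> /bin_sep_inj[-> ->]; exists G.
- by move=> /bin_sep_inj[-> /bin_sep_inj[-> ->]]; exists G.
- by move=> /bin_sep_inj[-> /bin_sep_inj[-> ->]]; exists G.
- by move=> /bin_sep_inj[-> /natlist_inj[-> ->]]; exists G.
- by move=> ->; exists G.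
- by move=> /enc_tform_inj[-> ->]; exists G'.
- by move=> /enc_tform_inj[-> ->]; exists G'.
Qed.

(** * Teams as third-order objects *)

Definition relP (R : nat -> nat -> Prop) : seq nat -> Prop :=
  fun l => if l is [:: a; b] then R a b else False.
Definition rel_trace (t : trace) : seq nat -> Prop := relP (fun i p => t i p).
(** A third-order variable ranges over arbitrary predicates on lists; its team is read off from the
    one-element lists that hold the relation of a trace, so several predicates stand for the same
    team. *)
Definition teamOf (A : seq (seq nat -> Prop) -> Prop) : team := fun t => A [:: rel_trace t].

Lemma relP_arity R : arityOK 2 (relP R).
Proof. by case=> [|a [|b [|c l]]]. Qed.

Lemma arity2_relP P : arityOK 2 P -> P = relP (fun a b => P [:: a; b]).
Proof.
move=> HP; apply/funext=> l; rewrite propeqE.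
by case: l => [|a [|b [|c l]]] /=; split=> // /HP.
Qed.

(** Relations are propositional and traces boolean, so classical truth values are taken;
    second-order quantifiers of arity 2 then range over exactly the traces. *)
Lemma arity2_trace P : arityOK 2 P -> exists t, P = rel_trace t.
Proof.
move=> /arity2_relP->; exists (fun a b => `[< P [:: a; b] >]).
congr relP; apply/funext=> a; apply/funext=> b; rewrite propeqE.
by split=> /asboolP.
Qed.

Lemma all2_trace Phi :
  (forall P, arityOK 2 P -> Phi P) <-> forall t : trace, Phi (rel_trace t).
Proof.
split=> H; first by move=> t; apply/H/relP_arity.
by move=> P /arity2_trace[t ->].
Qed.

Lemma ex2_trace Phi :
  (exists P, arityOK 2 P /\ Phi P) <-> exists t : trace, Phi (rel_trace t).
Proof.
split=> [[P [/arity2_trace[t ->] Ht]]|[t Ht]]; first by exists t.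
by exists (rel_trace t); split=> //; apply: relP_arity.
Qed.

Lemma ex2_rel Phi :
  (exists P, arityOK 2 P /\ Phi P) <-> exists R, Phi (relP R).
Proof.
split=> [[P [/arity2_relP-> HR]]|[R HR]]; first by eexists; apply: HR.
by exists (relP R); split=> //; apply: relP_arity.
Qed.

Definition ofTeam (X : team) : seq (seq nat -> Prop) -> Prop :=
  fun l => if l is [:: P] then exists2 t, X t & P = rel_trace t else False.

Lemma rel_trace_inj : injective rel_trace.
Proof.
move=> t s E; apply/funext=> i; apply/funext=> p.
by have := congr1 (fun P => P [:: i; p]) E; rewrite propeqE /= => H; apply/idP/idP => /H.
Qed.

Lemma ofTeamK X : teamOf (ofTeam X) = X.
Proof.
apply/funext=> t; rewrite propeqE /teamOf /=; split=> [[s Xs /rel_trace_inj->]//|Xt].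
by exists t.
Qed.

Notation V := AVar.

(* Finitely many variables suffice, since inner quantifiers shadow outer ones.
   First order:  0 number of worlds, 1 root, 2 row, 3 column or numeral being
   read, 4 and 5 their next values, 6 and 7 arguments in pointwise equalities,
   8 and 9 time shifts; 4 to 7 also serve as local bound variables.
   Second order, all of arity 2:  0 the structure read so far, 1 its next value,
   2 and 3 traces, 4 a path.
   Third order, all of type [2]:  0 the current team, 1 and 2 auxiliary teams. *)
Definition fimp F G := FOr (FNot F) G.
Definition fiff F G := FAnd (fimp F G) (fimp G F).
Definition memT (X t : nat) : tform := FTO X [:: 2] [:: (t, 2)].
Definition bin2 (P : nat) (a b : aterm) : tform := FSO P 2 [:: a; b].

Lemma or_implyP (P Q : Prop) : (~ P \/ Q) <-> (P -> Q).
Proof. by rewrite -implyE. Qed.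

Lemma and_or_iffP (P Q : Prop) : (~ P \/ Q) /\ (~ Q \/ P) <-> (P <-> Q).
Proof. by rewrite -!implyE. Qed.

Lemma and_or_iffPr (P Q R : Prop) :
  (Q <-> R) -> (~ P \/ Q) /\ (~ Q \/ P) <-> (P <-> R).
Proof. by move=> E; rewrite and_or_iffP E. Qed.

Definition shifted (t s : nat) (k : aterm) : tform :=
  FAll1 6 (FAll1 7 (fiff (bin2 t (V 7) (V 6)) (bin2 s (APlus k (V 7)) (V 6)))).
Definition isShift (X Y : nat) (k : aterm) : tform :=
  FAll2 2 2 (fiff (memT X 2) (FEx2 3 2 (FAnd (memT Y 3) (shifted 2 3 k)))).
Definition isUnion : tform := FAll2 2 2 (fiff (memT 0 2) (FOr (memT 1 2) (memT 2 2))).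
(** Equality of traces is expressed as a shift by zero; likewise a team is copied by [isShift] with
    [AZero]. *)
Definition isSingleton : tform := FAll2 3 2 (fiff (memT 0 3) (shifted 3 2 AZero)).

(** [shifted] evaluates [k] under its own quantifiers over 6 and 7, which must not capture a
    variable of [k]. *)
Definition stable67 (k : aterm) : Prop :=
  forall e u v, aeval (upd1 (upd1 e 6 u) 7 v) k = aeval e k.

Lemma shiftedP e1 e2 e3 a b k t s : stable67 k ->
  e2 a 2 = rel_trace t -> e2 b 2 = rel_trace s ->
  tsat3 e1 e2 e3 (shifted a b k) <-> t = (fun i => s (aeval e1 k + i)).
Proof.
move=> Hk Ea Eb; rewrite /shifted; split=> [H|E p i].
  apply/funext=> i; apply/funext=> p; move: (H p i); rewrite /= Ea Eb Hk /= => /and_or_iffP E.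
  by apply/idP/idP => /E.
by rewrite /= Ea Eb Hk /= E; apply/and_or_iffP.
Qed.

Lemma isShiftP e1 e2 e3 X Y k : stable67 k ->
  tsat3 e1 e2 e3 (isShift X Y k) <->
  teamOf (e3 X [:: 2]) = shiftT (aeval e1 k) (teamOf (e3 Y [:: 2])).
Proof.
move=> Hk; apply: iff_trans (all2_trace _) _.
have body t : tsat3 e1 (upd2 e2 2 2 (rel_trace t)) e3
    (fiff (memT X 2) (FEx2 3 2 (FAnd (memT Y 3) (shifted 2 3 k)))) <->
    (teamOf (e3 X [:: 2]) t <-> shiftT (aeval e1 k) (teamOf (e3 Y [:: 2])) t).
  apply: and_or_iffPr.
  apply: iff_trans (ex2_trace _) _.
  pose e2' s := upd2 (upd2 e2 2 2 (rel_trace t)) 3 2 (rel_trace s).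
  have E s := @shiftedP e1 (e2' s) e3 2 3 k t s Hk erefl erefl.
  by split=> -[s [Ys Es]]; exists s; split=> //; [apply: (proj1 (E s))|apply: (proj2 (E s))].
split=> [H|E t]; last by apply/body; rewrite E.
by apply/funext=> t; rewrite propeqE; apply/body.
Qed.

Lemma isUnionP e1 e2 e3 :
  tsat3 e1 e2 e3 isUnion <->
  forall t, teamOf (e3 0 [:: 2]) t <-> teamOf (e3 1 [:: 2]) t \/ teamOf (e3 2 [:: 2]) t.
Proof.
apply: iff_trans (all2_trace _) _.
by split=> H t; [apply: (proj1 (and_or_iffP _ _) (H t))|apply: (proj2 (and_or_iffP _ _) (H t))].
Qed.

Lemma isSingletonP e1 e2 e3 t : e2 2 2 = rel_trace t ->
  tsat3 e1 e2 e3 isSingleton <-> teamOf (e3 0 [:: 2]) = (fun s => s = t).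
Proof.
move=> Et; apply: iff_trans (all2_trace _) _.
have body s : tsat3 e1 (upd2 e2 3 2 (rel_trace s)) e3
    (fiff (memT 0 3) (shifted 3 2 AZero)) <-> (teamOf (e3 0 [:: 2]) s <-> s = t).
  apply: and_or_iffPr.
  exact: (@shiftedP _ _ _ 3 2 AZero s t).
split=> [H|E s]; last by apply/body; rewrite E.
by apply/funext=> s; rewrite propeqE; apply/body.
Qed.

(** * The translation of formulas *)

Definition cZero : seq frame := [:: KE1 3; KAnd (FEq (V 3) AZero)].
Definition two := APlus AOne AOne.
(** The graph of [bstep] from variable 3 to variable 5; for the digit 0 the predecessor in [x.*2.-1]
    is moved to the other side. The value 1, a numeral that starts with zero, satisfies neither
    disjunct. *)
Definition bitF (b : bool) : tform :=
  if b then FOr (FAnd (FEq (V 3) AZero) (FEq (V 5) two))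
                (FAnd (FLe two (V 3)) (FEq (V 5) (APlus (V 3) (V 3))))
  else FOr (FAnd (FEq (V 3) AZero) (FEq (V 5) AOne))
           (FAnd (FLe two (V 3)) (FEq (APlus (V 5) AOne) (APlus (V 3) (V 3)))).
(** Binding 3 at once would hide the old value that [bitF] mentions, so the next value is first
    bound to 5 and then copied. [cBody] follows the same scheme. *)
Definition cBit (b : bool) : seq frame :=
  [:: KE1 5; KAnd (bitF b); KE1 3; KAnd (FEq (V 3) (V 5))].
Definition atomF : tform :=
  FEx1 4 (FAnd (FEq (APlus (V 4) AOne) (V 3))
    (FAll2 2 2 (fimp (memT 0 2) (bin2 2 AZero (V 4))))).

(** The operand has to come last, so the clause is read as: for no trace [t] of the team does the
    singleton of [t] satisfy it. Membership is stated before variable 0 is rebound to the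
    singleton. *)
Definition cNeg : seq frame :=
  [:: KA2 2 2; KNot; KAnd (memT 0 2); KE3 0 [:: 2]; KAnd isSingleton].
Definition cSave : seq frame := [:: KE3 1 [:: 2]; KAnd (isShift 1 0 AZero)].
Definition cLoad (X : nat) (k : aterm) : seq frame := [:: KE3 0 [:: 2]; KAnd (isShift 0 X k)].
(** The new value of variable 0 hides the old one, so the team to be shifted is first copied to
    variable 1. *)
Definition cShift (k : aterm) : seq frame := cSave ++ cLoad 1 k.
Definition lt98 : tform := FLe (APlus (V 9) AOne) (V 8).

Definition cOr1 : seq frame :=
  [:: KE3 1 [:: 2]; KE3 2 [:: 2]; KAnd isUnion] ++ cLoad 2 AZero.
Definition cOr2 : seq frame := cLoad 1 AZero.
Definition cU1 : seq frame := KE1 8 :: cShift (V 8).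
Definition cU2 : seq frame := [:: KA1 9; KOr (FNot lt98)] ++ cLoad 1 (V 9).
Definition cR1 : seq frame := KA1 8 :: cShift (V 8).
Definition cR2 : seq frame := [:: KE1 9; KAnd lt98] ++ cLoad 1 (V 9).

(* Nothing is inserted between the two operands of a binary connective:
   the second operand finds its team in variable 0, the first one, wrapped in the
   second context, recovers its own from variable 1.  Hence the encoding of [tr f]
   is the image of the encoding of [f] under a letter-to-word map. *)
Fixpoint tr (f : ltl) : tform :=
  match f with
  | LAtom p => plug (cZero ++ flatten (map cBit (bits p))) atomF
  | LNeg g => plug cNeg (tr g)
  | LAnd g h => FAnd (tr g) (tr h)
  | LOr g h => plug cOr1 (FAnd (plug cOr2 (tr g)) (tr h))
  | LX g => plug (cShift AOne) (tr g)
  | LF g => plug (KE1 8 :: cShift (V 8)) (tr g)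
  | LG g => plug (KA1 8 :: cShift (V 8)) (tr g)
  | LU g h => plug cU1 (FAnd (plug cU2 (tr g)) (tr h))
  | LR g h => plug cR1 (FOr (plug cR2 (tr g)) (tr h))
  | LSim g => plug [:: KNot] (tr g)
  end.

(** * Correctness of the translation of formulas *)

Lemma plug_cat c d G : plug (c ++ d) G = plug c (plug d G).
Proof. by rewrite /plug foldr_cat. Qed.

Lemma shiftT0 X : shiftT 0 X = X.
Proof.
apply/funext=> t; rewrite propeqE; split=> [[s [Xs ->]]//|Xt].
by exists t.
Qed.

Section Congruence.
Variables (e1 : env1) (e2 : env2) (e3 : env3).

Lemma tsat3_And F G P Q : (tsat3 e1 e2 e3 F <-> P) -> (tsat3 e1 e2 e3 G <-> Q) ->
  tsat3 e1 e2 e3 (FAnd F G) <-> P /\ Q.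
Proof. by move=> EF EG; split=> -[/EF ? /EG ?]. Qed.

Lemma tsat3_Or F G P Q : (tsat3 e1 e2 e3 F <-> P) -> (tsat3 e1 e2 e3 G <-> Q) ->
  tsat3 e1 e2 e3 (FOr F G) <-> P \/ Q.
Proof. by move=> EF EG; split=> -[/EF|/EG]; [left|right|left|right]. Qed.

Lemma tsat3_imp F G P Q : (tsat3 e1 e2 e3 F <-> P) -> (tsat3 e1 e2 e3 G <-> Q) ->
  tsat3 e1 e2 e3 (fimp F G) <-> (P -> Q).
Proof. by move=> EF EG; apply: iff_trans (or_implyP _ _) _; split=> H /EF/H/EG. Qed.

Lemma tsat3_iff F G P Q : (tsat3 e1 e2 e3 F <-> P) -> (tsat3 e1 e2 e3 G <-> Q) ->
  tsat3 e1 e2 e3 (fiff F G) <-> (P <-> Q).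
Proof. 
move=> EF EG; apply: iff_trans (and_or_iffP _ _) _.
by split=> H; (split; [move=> /EF/H/EG|move=> /EG/H/EF]). Qed.

Lemma tsat3_Ex1 i F P : (forall v, tsat3 (upd1 e1 i v) e2 e3 F <-> P v) ->
  tsat3 e1 e2 e3 (FEx1 i F) <-> exists v, P v.
Proof. by move=> EF; split=> -[v Hv]; exists v; apply/EF. Qed.

Lemma tsat3_All1 i F P : (forall v, tsat3 (upd1 e1 i v) e2 e3 F <-> P v) ->
  tsat3 e1 e2 e3 (FAll1 i F) <-> forall v, P v.
Proof. by move=> EF; split=> H v; apply/EF. Qed.

Lemma tsat3_Ex2_rel j F P : (forall R, tsat3 e1 (upd2 e2 j 2 (relP R)) e3 F <-> P R) ->
  tsat3 e1 e2 e3 (FEx2 j 2 F) <-> exists R, P R.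
Proof.
move=> EF; apply: iff_trans (ex2_rel _) _.
by split=> -[R HR]; exists R; apply/EF.
Qed.

Lemma tsat3_All2_trace j F P :
  (forall t, tsat3 e1 (upd2 e2 j 2 (rel_trace t)) e3 F <-> P t) ->
  tsat3 e1 e2 e3 (FAll2 j 2 F) <-> forall t, P t.
Proof.
move=> EF; apply: iff_trans (all2_trace _) _.
by split=> H t; [apply/(EF t)/H|apply/(proj2 (EF t))/H].
Qed.

End Congruence.

(** [Phi] takes the teams in variables 0 and 1 because after a load the second operand of a binary
    connective still reads the former while the first recovers its own from the latter. *)
Lemma tsat3_load e1 e2 e3 X k G (Phi : team -> team -> Prop) : X != 0 -> stable67 k ->
  (forall e3, tsat3 e1 e2 e3 G <-> Phi (teamOf (e3 0 [:: 2])) (teamOf (e3 1 [:: 2]))) ->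
  tsat3 e1 e2 e3 (plug (cLoad X k) G) <->
  Phi (shiftT (aeval e1 k) (teamOf (e3 X [:: 2]))) (teamOf (e3 1 [:: 2])).
Proof.
move=> X0 Hk HG.
have E A : tsat3 e1 e2 (upd3 e3 0 [:: 2] A) (isShift 0 X k) <->
    teamOf A = shiftT (aeval e1 k) (teamOf (e3 X [:: 2])).
  by apply: iff_trans (isShiftP _ _ _ _ _ Hk) _; rewrite /upd3 /= (negPf X0).
split=> [[A [/E EA /HG]]|H]; first by rewrite -EA.
exists (ofTeam (shiftT (aeval e1 k) (teamOf (e3 X [:: 2])))).
split; first by apply/E; rewrite ofTeamK.
by apply/HG; rewrite [upd3 _ _ _ _ _ _]/= ofTeamK.
Qed.

Lemma tsat3_save e1 e2 e3 G (Phi : team -> team -> Prop) :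
  (forall e3, tsat3 e1 e2 e3 G <-> Phi (teamOf (e3 0 [:: 2])) (teamOf (e3 1 [:: 2]))) ->
  tsat3 e1 e2 e3 (plug cSave G) <-> Phi (teamOf (e3 0 [:: 2])) (teamOf (e3 0 [:: 2])).
Proof.
move=> HG.
have E A : tsat3 e1 e2 (upd3 e3 1 [:: 2] A) (isShift 1 0 AZero) <->
    teamOf A = teamOf (e3 0 [:: 2]).
  by apply: iff_trans (isShiftP _ _ _ _ _ _) _ => //; rewrite /= shiftT0.
split=> [[A [/E EA /HG]]|H]; first by rewrite -[X in Phi X]/(teamOf (e3 0 [:: 2])) -EA.
by exists (e3 0 [:: 2]); split; [apply/E|apply/HG].
Qed.

Lemma tsat3_split e1 e2 e3 G (Phi : team -> team -> Prop) :
  (forall e3, tsat3 e1 e2 e3 G <-> Phi (teamOf (e3 1 [:: 2])) (teamOf (e3 2 [:: 2]))) ->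
  tsat3 e1 e2 e3 (plug [:: KE3 1 [:: 2]; KE3 2 [:: 2]; KAnd isUnion] G) <->
  exists S U : team, (forall t, teamOf (e3 0 [:: 2]) t <-> S t \/ U t) /\ Phi S U.
Proof.
move=> HG; split=> [[A [B [/isUnionP EAB /HG H]]]|[S [U [E H]]]].
  by exists (teamOf A), (teamOf B); split; [exact: EAB|exact: H].
exists (ofTeam S), (ofTeam U); split; first by apply/isUnionP; rewrite /= !ofTeamK.
by apply/HG; rewrite [upd3 _ _ _ _ _ _]/= [upd3 _ _ _ _ 1 _]/= !ofTeamK.
Qed.

Lemma tsat3_shift e1 e2 e3 k G f : stable67 k ->
  (forall e1 e2 e3, tsat3 e1 e2 e3 G <-> tsat (teamOf (e3 0 [:: 2])) f) ->
  tsat3 e1 e2 e3 (plug (cShift k) G) <-> tsat (shiftT (aeval e1 k) (teamOf (e3 0 [:: 2]))) f.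
Proof.
move=> Hk HG; rewrite plug_cat.
apply: (tsat3_save _ (Phi := fun _ X => tsat (shiftT (aeval e1 k) X) f)) => e3'.
exact: (tsat3_load _ (Phi := fun X _ => tsat X f)).
Qed.

Lemma bitFP e1 e2 e3 b : tsat3 e1 e2 e3 (bitF b) <-> bstep (e1 3) b = Some (e1 5).
Proof.
case: b => /=; case: (e1 3) => [|[|x]] /=; split=> //.
- by case=> -[] // _ ->.
- by case=> <-; left.
- by case=> -[].
- by case=> -[//] _ ->; congr Some; lia.
- by case=> <-; right; split=> //; lia.
- by case=> -[] // _ ->.
- by case=> <-; left.
- by case=> -[].
- by case=> -[//] _ E; congr Some; lia.
- by case=> <-; right; split=> //; lia.
Qed.

Lemma cBitP e1 e2 e3 b G :
  tsat3 e1 e2 e3 (plug (cBit b) G) <->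
  exists2 z, bstep (e1 3) b = Some z & tsat3 (upd1 (upd1 e1 5 z) 3 z) e2 e3 G.
Proof.
split=> [[z [/bitFP /= Ez [w [Ew HG]]]]|[z Ez HG]].
  by exists z => //; rewrite (Ew : w = z) in HG.
exists z; split; first by apply/bitFP.
by exists z; split.
Qed.

Lemma tsat3_bits e1 e2 e3 bs :
  tsat3 e1 e2 e3 (plug (flatten (map cBit bs)) atomF) <->
  exists2 p, bfold (e1 3) bs = Some p.+1 & forall t, teamOf (e3 0 [:: 2]) t -> t 0 p.
Proof.
elim: bs e1 => [|b bs IHbs] e1.
  split=> [[p [Ep /all2_trace H]]|[p [Ep] H]].
    exists p; first by rewrite /bfold /= -(Ep : p + 1 = e1 3) addn1.
    by move=> t; apply: (proj1 (or_implyP _ _) (H t)).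
  exists p; split; first by suff: p + 1 = e1 3 by []; rewrite addn1 Ep.
  by apply/all2_trace=> t; apply: (proj2 (or_implyP _ _)); apply: H.
rewrite -[flatten _]/(cBit b ++ flatten (map cBit bs)) plug_cat cBitP bfold_cons.
split=> [[z -> /IHbs]//|[p]].
by case E: (bstep (e1 3) b) => [z|] //= Ep H; exists z => //; apply/IHbs; exists p.
Qed.

(** Truth depends on the environments only through the team in variable 0. Being uniform in all
    environments, the induction hypothesis survives every rebinding of names by the contexts. *)
Theorem tsat3_tr f e1 e2 e3 :
  tsat3 e1 e2 e3 (tr f) <-> tsat (teamOf (e3 0 [:: 2])) f.
Proof.
elim: f e1 e2 e3 => [p|g IHg|g IHg h IHh|g IHg h IHh|g IHg|g IHg|g IHg
  |g IHg h IHh|g IHg h IHh|g IHg] e1 e2 e3.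
- rewrite -[tr _]/(plug (cZero ++ _) _) plug_cat; split=> [[x [E0 /tsat3_bits[q]]]|H].
    by rewrite (E0 : upd1 e1 3 x 3 = 0) bfold_bits => -[->].
  by exists 0; split=> //; apply/tsat3_bits; exists p; rewrite // bfold_bits.
- have E t :
      tsat3 e1 (upd2 e2 2 2 (rel_trace t)) e3
        (plug [:: KE3 0 [:: 2]; KAnd isSingleton] (tr g)) <-> tsat (fun s => s = t) g.
    split=> [[A [/(proj1 (@isSingletonP _ _ _ t erefl)) EA /IHg]]|H].
      by rewrite EA.
    exists (ofTeam (fun s => s = t)); split.
      by apply: (proj2 (@isSingletonP _ _ _ t erefl)); rewrite /= ofTeamK.
    by apply/IHg; rewrite [upd3 _ _ _ _ _ _]/= ofTeamK.
  apply: (tsat3_All2_trace (P := fun t => teamOf (e3 0 [:: 2]) t ->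
    ~ tsat (fun s => s = t) g)) => t.
  split=> [H Tt Ht|H [Tt Ht]]; first by apply: H; split; [exact: Tt|apply/E].
  by apply: (H Tt); apply/E.
- exact: tsat3_And.
- rewrite -[tr _]/(plug (_ ++ _) _) plug_cat.
  apply: (tsat3_split _ (Phi := fun S U => tsat S g /\ tsat U h)) => e3'.
  (* The right operand finds [U] in variable 0 as the shift by zero of variable 2. *)
  rewrite -[X in tsat X h]shiftT0.
  apply: (tsat3_load _ (Phi := fun X S => tsat S g /\ tsat X h)) => // e4.
  apply: tsat3_And => //; rewrite -[X in tsat X g]shiftT0.
  exact: (tsat3_load _ (Phi := fun X _ => tsat X g)).
- exact: tsat3_shift.
- by apply: tsat3_Ex1 => k; apply: tsat3_shift.
- by apply: tsat3_All1 => k; apply: tsat3_shift.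
- apply: tsat3_Ex1 => k; rewrite plug_cat.
  apply: (tsat3_save _ (Phi := fun _ X => tsat (shiftT k X) h /\
    forall j, j < k -> tsat (shiftT j X) g)) => e3'.
  apply: (tsat3_load _ (Phi := fun X S => tsat X h /\
    forall j, j < k -> tsat (shiftT j S) g)) => // e4.
  (* The output keeps the order of the operands, whereas the semantic clause states the right
     operand first. *)
  rewrite and_comm; apply: tsat3_And => //; apply: tsat3_All1 => j.
  apply: tsat3_imp; first by rewrite /= addn1.
  exact: (tsat3_load _ (Phi := fun X _ => tsat X g)).
- apply: tsat3_All1 => k; rewrite plug_cat.
  apply: (tsat3_save _ (Phi := fun _ X => tsat (shiftT k X) h \/
    exists j, j < k /\ tsat (shiftT j X) g)) => e3'.
  apply: (tsat3_load _ (Phi := fun X S => tsat X h \/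
    exists j, j < k /\ tsat (shiftT j S) g)) => // e4.
  rewrite or_comm; apply: tsat3_Or => //; apply: tsat3_Ex1 => j.
  apply: tsat3_And; first by rewrite /= addn1.
  exact: (tsat3_load _ (Phi := fun X _ => tsat X g)).
- by rewrite /= IHg.
Qed.

(** * Reading a Kripke structure *)

(* [sD] collects both relations of the structure: row [w < n] holds the
   successors of [w], row [n + w] the labels of [w], shifted by one. *)
Record kstate := KState { sn : nat; sr : nat; si : nat; sx : nat; sD : nat -> nat -> Prop }.

Definition addD (D : nat -> nat -> Prop) (i x : nat) : nat -> nat -> Prop :=
  fun u v => D u v \/ (u = i /\ v = x).

(** One pair of counters serves both phases: while [i < n], [x] is the column in row [i] of the
    matrix; afterwards [i - n] is the world whose labels are read and [x] the numeral so far. *)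
Definition bitStep (s : kstate) (b : bool) : option kstate :=
  let: KState n r i x D := s in
  if i < n then if x < n then Some (KState n r i x.+1 (if b then addD D i x else D)) else None
  else omap (fun z => KState n r i z D) (bstep x b).

(** A surplus empty list of labels is not rejected on the spot: [trp] only advances [i], and the
    final test [i = n + n] excludes it. *)
Definition bodyStep (s : kstate) (a : tok) : option kstate :=
  let: KState n r i x D := s in
  match a with
  | t0 => bitStep s false
  | t1 => bitStep s true
  | tsep => if i < n then if x == n then Some (KState n r i.+1 0 D) else None
            else if (0 < x) && (i < n + n) then Some (KState n r i 0 (addD D i x)) else None
  | trp => if (n <= i) && (x == 0) then Some (KState n r i.+1 0 D) else None
  | _ => None
  end.

Definition stOf (e1 : env1) (e2 : env2) : kstate :=
  KState (e1 0) (e1 1) (e1 2) (e1 3) (fun u v => e2 0 2 [:: u; v]).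

Definition ltF (a b : aterm) : tform := FLe (APlus a AOne) b.
Definition sameD : tform :=
  FAll1 6 (FAll1 7 (fiff (bin2 1 (V 6) (V 7)) (bin2 0 (V 6) (V 7)))).
Definition consD : tform :=
  FAll1 6 (FAll1 7 (fiff (bin2 1 (V 6) (V 7))
    (FOr (bin2 0 (V 6) (V 7)) (FAnd (FEq (V 6) (V 2)) (FEq (V 7) (V 3)))))).
Definition setIX (a b : aterm) (F : tform) : tform :=
  FAnd (FEq (V 4) a) (FAnd (FEq (V 5) b) F).

Definition bitBodyF (b : bool) : tform :=
  FOr (FAnd (ltF (V 2) (V 0)) (FAnd (ltF (V 3) (V 0))
        (setIX (V 2) (APlus (V 3) AOne) (if b then consD else sameD))))
      (FAnd (FLe (V 0) (V 2)) (FAnd (bitF b) (setIX (V 2) (V 5) sameD))).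
Definition bodyF (a : tok) : tform :=
  match a with
  | t0 => bitBodyF false
  | t1 => bitBodyF true
  | tsep =>
    FOr (FAnd (ltF (V 2) (V 0)) (FAnd (FEq (V 3) (V 0)) (setIX (APlus (V 2) AOne) AZero sameD)))
        (FAnd (FLe (V 0) (V 2)) (FAnd (ltF AZero (V 3))
           (FAnd (ltF (V 2) (APlus (V 0) (V 0))) (setIX (V 2) AZero consD))))
  | _ => FAnd (FLe (V 0) (V 2)) (FAnd (FEq (V 3) AZero) (setIX (APlus (V 2) AOne) AZero sameD))
  end.

Definition cBody (a : tok) : seq frame :=
  [:: KE1 4; KE1 5; KE2 1 2; KAnd (bodyF a); KE1 2; KAnd (FEq (V 2) (V 4));
      KE1 3; KAnd (FEq (V 3) (V 5)); KE2 0 2; KAnd sameD].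
Definition cSet (i : nat) : seq frame :=
  [:: KE1 i; KAnd (FEq (APlus (V i) AOne) (V 3)); KE1 3; KAnd (FEq (V 3) AZero)].

Definition okF : tform :=
  FAnd (FEq (V 2) (APlus (V 0) (V 0))) (FAnd (FEq (V 3) AZero) (FAnd (ltF (V 1) (V 0))
    (FAll1 4 (fimp (ltF (V 4) (V 0)) (FEx1 5 (FAnd (ltF (V 5) (V 0)) (bin2 0 (V 4) (V 5)))))))).
Definition stateF : tform :=
  FAnd (ltF (V 4) (V 0))
    (FAnd (FAll1 6 (fiff (bin2 2 (V 7) (V 6)) (bin2 0 (APlus (V 0) (V 4)) (APlus (V 6) AOne))))
          (FEx1 5 (FAnd (bin2 4 (APlus (V 7) AOne) (V 5)) (bin2 0 (V 4) (V 5))))).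
(** Variable 4 is a relation between times and worlds that need not be functional: it contains the
    root at time 0, all its worlds carry the right labels, and each has a successor inside it.
    Dependent choice then finds a path. *)
Definition pathF : tform :=
  FEx2 4 2 (FAnd (bin2 4 AZero (V 1))
    (FAll1 7 (FAll1 4 (fimp (bin2 4 (V 7) (V 4)) stateF)))).
Definition teamF : tform := FAll2 2 2 (fiff (memT 0 2) pathF).
Definition cFinal : seq frame := [:: KAnd okF; KE3 0 [:: 2]; KAnd teamF].
(** Variables 0 and 1 receive arbitrary values, which the two numerals of the header replace;
    binding them here keeps the scope constant while the structure is read. *)
Definition cInit : seq frame :=
  [:: KE1 0; KE1 1; KE1 2; KAnd (FEq (V 2) AZero); KE1 3; KAnd (FEq (V 3) AZero);
      KE2 0 2; KAnd (FAll1 6 (FAll1 7 (FNot (bin2 0 (V 6) (V 7)))))].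

Definition kok (s : kstate) : Prop :=
  [/\ si s = sn s + sn s, sx s = 0, sr s < sn s &
      forall w, w < sn s -> exists v, v < sn s /\ sD s w v].
Definition kteam (s : kstate) : team := fun t =>
  exists pi : nat -> nat, pi 0 = sr s /\ forall i,
    (pi i < sn s /\ forall p, t i p <-> sD s (sn s + pi i) p.+1) /\ sD s (pi i) (pi i.+1).

Section Envs.
Variables (e1 : env1) (e2 : env2) (e3 : env3).

Lemma ltFP a b : tsat3 e1 e2 e3 (ltF a b) <-> aeval e1 a < aeval e1 b.
Proof. by rewrite /= addn1. Qed.

Lemma sameDP : tsat3 e1 e2 e3 sameD <->
  (fun u v => e2 1 2 [:: u; v]) = (fun u v => e2 0 2 [:: u; v]).
Proof.
split=> [H|E u v].
  by apply/funext=> u; apply/funext=> v; rewrite propeqE; apply/and_or_iffP/(H u v).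
by apply/and_or_iffP; have := congr1 (fun D => D u v) E => /= ->.
Qed.

Lemma consDP : tsat3 e1 e2 e3 consD <->
  (fun u v => e2 1 2 [:: u; v]) = addD (fun u v => e2 0 2 [:: u; v]) (e1 2) (e1 3).
Proof.
split=> [H|E u v].
  by apply/funext=> u; apply/funext=> v; rewrite propeqE; apply/and_or_iffP/(H u v).
by apply/and_or_iffP; have := congr1 (fun D => D u v) E => /= ->.
Qed.

Lemma setIXP a b F P : (tsat3 e1 e2 e3 F <-> P) ->
  tsat3 e1 e2 e3 (setIX a b F) <-> [/\ e1 4 = aeval e1 a, e1 5 = aeval e1 b & P].
Proof. by move=> EF; split=> [[? [? /EF ?]]|[? ? /EF ?]]. Qed.

Definition nextOf : kstate :=
  KState (e1 0) (e1 1) (e1 4) (e1 5) (fun u v => e2 1 2 [:: u; v]).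

Lemma bitBodyFP b : tsat3 e1 e2 e3 (bitBodyF b) <-> bitStep (stOf e1 e2) b = Some nextOf.
Proof.
set D := fun u v => e2 0 2 [:: u; v]; set D' := fun u v => e2 1 2 [:: u; v].
have -> : tsat3 e1 e2 e3 (bitBodyF b) <->
    (e1 2 < e1 0 /\ (e1 3 < e1 0 /\ [/\ e1 4 = e1 2, e1 5 = e1 3 + 1 &
       D' = if b then addD D (e1 2) (e1 3) else D])) \/
    (e1 0 <= e1 2 /\ (bstep (e1 3) b = Some (e1 5) /\ [/\ e1 4 = e1 2, e1 5 = e1 5 & D' = D])).
  apply: tsat3_Or.
    apply: tsat3_And (ltFP _ _) _; apply: tsat3_And (ltFP _ _) _; apply: setIXP.
    by case: b; [apply: consDP|apply: sameDP].
  by apply: tsat3_And => //; apply: tsat3_And (bitFP _ _ _ _) _; apply/setIXP/sameDP.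
rewrite /bitStep /stOf /nextOf -/D -/D'; case: (ltnP (e1 2) (e1 0)) => Hi.
  case: (ltnP (e1 3) (e1 0)) => Hx; split.
  - by case=> [[_ [_ [-> -> ->]]]|[? _]]; [rewrite addn1|lia].
  - by case=> <- <- <-; left; rewrite addn1.
  - by case=> -[? []]; lia.
  - by [].
split; first by case=> [[?]|[_ [E [-> _ ->]]]]; [lia|rewrite E].
by case E: (bstep _ _) => [z|] //= -[<- <- <-]; right.
Qed.

Lemma bodyFP a : (if a is (t0 | t1 | tsep | trp) then true else false) ->
  tsat3 e1 e2 e3 (bodyF a) <-> bodyStep (stOf e1 e2) a = Some nextOf.
Proof.
set D := fun u v => e2 0 2 [:: u; v]; set D' := fun u v => e2 1 2 [:: u; v].
case: a => // _; first exact: bitBodyFP; first exact: bitBodyFP.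
  have -> : tsat3 e1 e2 e3 (bodyF tsep) <->
      (e1 2 < e1 0 /\ (e1 3 = e1 0 /\ [/\ e1 4 = e1 2 + 1, e1 5 = 0 & D' = D])) \/
      (e1 0 <= e1 2 /\ (0 < e1 3 /\ (e1 2 < e1 0 + e1 0 /\
        [/\ e1 4 = e1 2, e1 5 = 0 & D' = addD D (e1 2) (e1 3)]))).
    apply: tsat3_Or.
      by apply: tsat3_And (ltFP _ _) _; apply: tsat3_And => //; apply/setIXP/sameDP.
    apply: tsat3_And => //; apply: tsat3_And (ltFP _ _) _; apply: tsat3_And (ltFP _ _) _.
    exact/setIXP/consDP.
  rewrite /bodyStep /stOf /nextOf -/D -/D'; case: (ltnP (e1 2) (e1 0)) => Hi.
    case: eqP => Hx; split.
    - by case=> [[_ [_ [-> -> ->]]]|[? _]]; [rewrite addn1|lia].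
    - by case=> <- <- <-; left; rewrite addn1.
    - by case=> -[? []]; lia.
    - by [].
  case: ifP => [/andP[H1 H2]|H]; split.
  - by case=> [[? _]|[_ [_ [_ [-> -> ->]]]]]; [lia|].
  - by case=> <- <- <-; right.
  - by case=> -[? [? []]]; lia.
  - by [].
have -> : tsat3 e1 e2 e3 (bodyF trp) <->
    (e1 0 <= e1 2 /\ (e1 3 = 0 /\ [/\ e1 4 = e1 2 + 1, e1 5 = 0 & D' = D])).
  by apply: tsat3_And => //; apply: tsat3_And => //; apply/setIXP/sameDP.
rewrite /bodyStep /stOf /nextOf -/D -/D'; case: ifP => [/andP[H1 /eqP H2]|H]; split.
- by case=> [_ [_ [-> -> ->]]]; rewrite addn1.
- by case=> <- <- <-; rewrite addn1.
- by case=> [? [? _]]; lia.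
- by [].
Qed.

End Envs.

Section Contexts.
Variables (e1 : env1) (e2 : env2) (e3 : env3) (G : tform).

(** The first half extracts the next state from the truth of the context. The second asks for [G]
    under all environments that represent the next state, because the context also changes auxiliary
    variables and only the state is tracked. *)
Definition refines (c : seq frame) (next : kstate -> option kstate) : Prop :=
  (tsat3 e1 e2 e3 (plug c G) -> exists e1' e2',
     next (stOf e1 e2) = Some (stOf e1' e2') /\ tsat3 e1' e2' e3 G) /\
  (forall s, next (stOf e1 e2) = Some s ->
     (forall e1' e2', stOf e1' e2' = s -> tsat3 e1' e2' e3 G) -> tsat3 e1 e2 e3 (plug c G)).

Lemma cBody_refines a : (if a is (t0 | t1 | tsep | trp) then true else false) ->
  refines (cBody a) (fun s => bodyStep s a).
Proof.
move=> Ha; split.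
  case=> i' [x' [P [_ [/(bodyFP _ _ _ Ha) E]]]].
  case=> i [Ei [x [Ex [Q [_ [/sameDP ED HG]]]]]].
  do 2 eexists; split; last exact: HG.
  rewrite [LHS]E; congr Some; rewrite /nextOf /stOf.
  by congr KState; [exact: esym Ei|exact: esym Ex|exact: ED].
case=> n r i x D E HG.
(* [cBody] does not rebind variables 0 and 1, so the step has to preserve both numbers. *)
have En : n = e1 0 /\ r = e1 1.
  move: E; rewrite /stOf; case: a Ha => // _ /=; rewrite /bitStep;
  by do 2? [case: ifP => // _]; try case: bstep => //= ?; case.
case: En E HG => -> -> E HG.
exists i, x, (relP D); split; first exact: relP_arity.
split; first by apply/(bodyFP _ _ _ Ha).
exists i; split=> //; exists x; split=> //.
exists (relP D); split; first exact: relP_arity.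
by split; [apply/sameDP|apply: HG].
Qed.

End Contexts.

(** * The reduction as a transducer *)

Inductive role := Size | Root | Atom.
Inductive progress := Start | Nonzero | Zero.
Inductive tstate := Num (r : role) (b : progress) | Body | Form | Bad.

Definition tstate_code (q : tstate) : option bool * option bool + option bool :=
  match q with
  | Num r b =>
    inl (match r with Size => None | Root => Some true | Atom => Some false end,
         match b with Start => None | Nonzero => Some true | Zero => Some false end)
  | Body => inr None
  | Form => inr (Some true)
  | Bad => inr (Some false)
  end.
Definition tstate_decode (c : option bool * option bool + option bool) : tstate :=
  match c with
  | inl (r, b) =>
    Num (match r with None => Size | Some true => Root | Some false => Atom end)
        (match b with None => Start | Some true => Nonzero | Some false => Zero end)
  | inr None => Body
  | inr (Some true) => Form
  | inr (Some false) => Bad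
  end.
Lemma tstate_codeK : cancel tstate_code tstate_decode.
Proof. by case=> [[] []|||]. Qed.
HB.instance Definition _ := Finite.copy tstate (can_type tstate_codeK).

Definition nxt (q : tstate) (a : tok) : tstate :=
  match q, a with
  | Num _ Zero, (t0 | t1) => Bad
  | Num r Start, t0 => Num r Zero
  | Num r _, (t0 | t1) => Num r Nonzero
  | Num _ Start, tsep => Bad
  | Num Size _, tsep => Num Root Start
  | Num Root _, tsep => Body
  | Num Atom _, tsep => Form
  | Body, (t0 | t1 | tsep | trp) => Body
  | Body, tlp => Form
  | Form, tAtom => Num Atom Start
  | Form, (tNeg | tAnd | tOr | tX | tF | tG | tU | tR | tSim) => Form
  | _, _ => Bad
  end.

(* No formula starts with [tsep], so a bad input yields an ill-formed output. *)
Definition out (q : tstate) (a : tok) : seq tok :=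
  match nxt q a, q, a with
  | Bad, _, _ => [:: tsep]
  | _, Num _ _, t0 => enc_ctx (cBit false)
  | _, Num _ _, t1 => enc_ctx (cBit true)
  | _, Num Size _, _ => enc_ctx (cSet 0)
  | _, Num Root _, _ => enc_ctx (cSet 1)
  | _, Num Atom _, _ => enc_tform atomF
  | _, Body, tlp => enc_ctx cFinal
  | _, Body, _ => enc_ctx (cBody a)
  | _, _, tAtom => enc_ctx cZero
  | _, _, tNeg => enc_ctx cNeg
  | _, _, tAnd => [:: tAnd]
  | _, _, tOr => enc_ctx cOr1 ++ tAnd :: enc_ctx cOr2
  | _, _, tX => enc_ctx (cShift AOne)
  | _, _, tF => enc_ctx (KE1 8 :: cShift (V 8))
  | _, _, tG => enc_ctx (KA1 8 :: cShift (V 8))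
  | _, _, tU => enc_ctx cU1 ++ tAnd :: enc_ctx cU2
  | _, _, tR => enc_ctx cR1 ++ tOr :: enc_ctx cR2
  | _, _, _ => enc_ctx [:: KNot]
  end.

Definition output : tstate -> seq tok -> seq tok := trans nxt out.

(** Projects the number kept by [bstep] to what the finite control remembers of it. *)
Definition cls (x : nat) : progress :=
  match x with 0 => Start | 1 => Zero | _ => Nonzero end.

Lemma nxt_bit r x b z : bstep x b = Some z ->
  nxt (Num r (cls x)) (enc_bit b) = Num r (cls z).
Proof.
case: x => [|[|x]] //= -[<-]; first by case: b; case: r.
have -> : cls (x.+2.*2.-1 + b) = Nonzero by rewrite !doubleS.
by case: b; case: r.
Qed.

Lemma out_bit r x b z : bstep x b = Some z ->
  out (Num r (cls x)) (enc_bit b) = enc_ctx (cBit b).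
Proof. by move=> E; rewrite /out (nxt_bit _ E); case: b E; case: r. Qed.

Lemma nxt_bad q a : nxt q a = Bad -> out q a = [:: tsep].
Proof. by rewrite /out => ->. Qed.

Lemma nxt_bit_bad r x b : bstep x b = None -> nxt (Num r (cls x)) (enc_bit b) = Bad.
Proof. by case: x => [|[|x]] //= _; case: b; case: r. Qed.

Lemma output_cons q a w : output q (a :: w) = out q a ++ output (nxt q a) w.
Proof. by []. Qed.

Lemma output_atom bs x p w : bfold x bs = Some p.+1 ->
  output (Num Atom (cls x)) (map enc_bit bs ++ tsep :: w)
  = enc_ctx (flatten (map cBit bs)) ++ enc_tform atomF ++ output Form w.
Proof.
elim: bs x => [|b bs IHbs] x; first by case: x => // x [->]; case: p => //.
rewrite bfold_cons; case E: (bstep x b) => [z|//] Ez.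
rewrite map_cons cat_cons output_cons (nxt_bit _ E) (out_bit _ E) (IHbs _ Ez).
by rewrite /enc_ctx map_cat flatten_cat -catA.
Qed.

Lemma enc_plugAnd c d F G : enc_tform (plug c (FAnd (plug d F) G))
  = (enc_ctx c ++ tAnd :: enc_ctx d) ++ enc_tform F ++ enc_tform G.
Proof. by rewrite enc_plug [enc_tform (FAnd _ _)]/= enc_plug -!catA. Qed.

Lemma enc_plugOr c d F G : enc_tform (plug c (FOr (plug d F) G))
  = (enc_ctx c ++ tOr :: enc_ctx d) ++ enc_tform F ++ enc_tform G.
Proof. by rewrite enc_plug [enc_tform (FOr _ _)]/= enc_plug -!catA. Qed.

Lemma output_ltl f w :
  output Form (enc_ltl f ++ w) = enc_tform (tr f) ++ output Form w.
Proof.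
elim: f w => [p|g IHg|g IHg h IHh|g IHg h IHh|g IHg|g IHg|g IHg
  |g IHg h IHh|g IHg h IHh|g IHg] w; rewrite [enc_ltl _]/= cat_cons output_cons.
- rewrite /binsep -enc_bits -!catA (output_atom _ (bfold_bits p)) enc_plug.
  by rewrite /enc_ctx map_cat flatten_cat -!catA.
- by rewrite IHg catA -enc_plug.
- by rewrite -catA IHg IHh /= -!catA.
- by rewrite -catA IHg IHh (enc_plugAnd cOr1 cOr2) -!catA.
- by rewrite IHg catA -enc_plug.
- by rewrite IHg catA -enc_plug.
- by rewrite IHg catA -enc_plug.
- by rewrite -catA IHg IHh (enc_plugAnd cU1 cU2) -!catA.
- by rewrite -catA IHg IHh (enc_plugOr cR1 cR2) -!catA.
- by rewrite IHg catA -enc_plug.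
Qed.

(** * Reading a formula back from the output *)

Lemma not_tform_sep s F r : tsep :: s <> enc_tform F ++ r.
Proof. by case: F. Qed.

Lemma parse_atom x w F r : output (Num Atom (cls x)) w = enc_tform F ++ r ->
  exists bs p s, [/\ w = map enc_bit bs ++ tsep :: s, bfold x bs = Some p.+1,
    F = plug (flatten (map cBit bs)) atomF & r = output Form s].
Proof.
elim: w x F => [|a w IHw] x F; first by case: F.
rewrite output_cons.
have bit b : out (Num Atom (cls x)) (enc_bit b)
      ++ output (nxt (Num Atom (cls x)) (enc_bit b)) w = enc_tform F ++ r ->
    exists bs p s, [/\ enc_bit b :: w = map enc_bit bs ++ tsep :: s, bfold x bs = Some p.+1,
      F = plug (flatten (map cBit bs)) atomF & r = output Form s].
  case E: (bstep x b) => [z|]; last by rewrite nxt_bad ?nxt_bit_bad // => /not_tform_sep.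
  rewrite (out_bit _ E) (nxt_bit _ E) => /parse_plug[G -> /IHw[bs [p [s [-> Ez -> ->]]]]].
  exists (b :: bs), p, s; split=> //; first by rewrite bfold_cons E.
case: a; try by rewrite nxt_bad; [move/not_tform_sep|case: (cls x)].
- exact: (bit false).
- exact: (bit true).
case: x {IHw bit} => [|p]; first by rewrite nxt_bad // => /not_tform_sep.
have -> : nxt (Num Atom (cls p.+1)) tsep = Form by case: p.
have -> : out (Num Atom (cls p.+1)) tsep = enc_tform atomF by case: p.
move=> /enc_tform_inj[<- <-]; by exists [::], p, w.
Qed.

Lemma parse_plugAnd c d s F r :
  (enc_ctx c ++ tAnd :: enc_ctx d) ++ s = enc_tform F ++ r ->
  exists G H, F = plug c (FAnd (plug d G) H) /\ s = enc_tform G ++ enc_tform H ++ r.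
Proof.
rewrite -catA => /parse_plug[] [] //= A B -> [].
by rewrite -catA => /parse_plug[G -> ->]; exists G, B.
Qed.

Lemma parse_plugOr c d s F r :
  (enc_ctx c ++ tOr :: enc_ctx d) ++ s = enc_tform F ++ r ->
  exists G H, F = plug c (FOr (plug d G) H) /\ s = enc_tform G ++ enc_tform H ++ r.
Proof.
rewrite -catA => /parse_plug[] [] //= A B -> [].
by rewrite -catA => /parse_plug[G -> ->]; exists G, B.
Qed.

(** Each token outputs a fixed context, which unique parsing peels off, or [tsep], with which no
    formula starts. The induction is on the length because a second operand is parsed from what the
    first leaves over. *)
Lemma parse_form w F r : output Form w = enc_tform F ++ r ->
  exists f s, [/\ w = enc_ltl f ++ s, F = tr f & r = output Form s].
Proof.
have [m] := ubnP (size w); elim: m w F r => // m IHm [|a w] F r; first by case: F.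
rewrite ltnS output_cons => Hm; have Hw : size w < m := Hm.
have IH1 c cf : (forall g, tr (cf g) = plug c (tr g)) ->
    (forall g, enc_ltl (cf g) = a :: enc_ltl g) ->
    enc_ctx c ++ output Form w = enc_tform F ++ r ->
    exists f s, [/\ a :: w = enc_ltl f ++ s, F = tr f & r = output Form s].
  move=> Etr Eenc /parse_plug[G -> /(IHm _ _ _ Hw)[g [s [-> -> ->]]]].
  by exists (cf g), s; rewrite Etr Eenc.
have IH2 G H : output Form w = enc_tform G ++ enc_tform H ++ r ->
    exists g h s, [/\ w = enc_ltl g ++ enc_ltl h ++ s, G = tr g, H = tr h & r = output Form s].
  move=> /(IHm _ _ _ Hw)[g [s [Ew -> /esym E]]].
  have [|h [s' [Es -> ->]]] := IHm s _ _ _ E.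
    by move: Hm; rewrite Ew /= size_cat; lia.
  by exists g, h, s'; rewrite Ew Es.
case: a IH1 {Hm}; try by move=> _ /not_tform_sep.
- move=> _ /parse_plug[G -> /(@parse_atom 0)[bs [p [s [-> /bfold_inv-> -> ->]]]]].
  exists (LAtom p), s; split=> //; rewrite ?plug_cat //.
    by rewrite /= enc_bits -catA.
- by move=> IH1; apply: (IH1 cNeg LNeg).
- move=> _ /(@parse_plugAnd [::] [::])[G [H [-> /IH2[g [h [s [-> -> -> ->]]]]]]].
  by exists (LAnd g h), s; rewrite /= -catA.
- move=> _ /parse_plugAnd[G [H [-> /IH2[g [h [s [-> -> -> ->]]]]]]].
  by exists (LOr g h), s; rewrite [enc_ltl _]/= cat_cons -catA.
- by move=> IH1; apply: (IH1 (cShift AOne) LX).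
- by move=> IH1; apply: (IH1 (KE1 8 :: cShift (V 8)) LF).
- by move=> IH1; apply: (IH1 (KA1 8 :: cShift (V 8)) LG).
- move=> _ /parse_plugAnd[G [H [-> /IH2[g [h [s [-> -> -> ->]]]]]]].
  by exists (LU g h), s; rewrite [enc_ltl _]/= cat_cons -catA.
- move=> _ /parse_plugOr[G [H [-> /IH2[g [h [s [-> -> -> ->]]]]]]].
  by exists (LR g h), s; rewrite [enc_ltl _]/= cat_cons -catA.
- by move=> IH1; apply: (IH1 [:: KNot] LSim).
Qed.

(** * Tokens of the structure as partial maps on states *)

Definition setX (s : kstate) (z : nat) : kstate := KState (sn s) (sr s) (si s) z (sD s).

Definition isK (q : tstate) : bool :=
  match q with Num (Size | Root) _ | Body => true | _ => false end.

Definition kstep (q : tstate) (a : tok) (s : kstate) : option kstate :=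
  match q, a with
  | Num (Size | Root) _, t0 => omap (setX s) (bstep (sx s) false)
  | Num (Size | Root) _, t1 => omap (setX s) (bstep (sx s) true)
  | Num Size _, tsep =>
    if sx s is p.+1 then Some (KState p (sr s) (si s) 0 (sD s)) else None
  | Num Root _, tsep =>
    if sx s is p.+1 then Some (KState (sn s) p (si s) 0 (sD s)) else None
  | Body, _ => bodyStep s a
  | _, _ => None
  end.

Definition kctx (q : tstate) (a : tok) : seq frame :=
  match q, a with
  | Num _ _, t0 => cBit false
  | Num _ _, t1 => cBit true
  | Num Size _, _ => cSet 0
  | Num Root _, _ => cSet 1
  | _, _ => cBody a
  end.

Lemma cBit_refines e1 e2 e3 G b :
  refines e1 e2 e3 G (cBit b) (fun s => omap (setX s) (bstep (sx s) b)).
Proof.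
split=> [/cBitP[z Ez HG]|s].
  by do 2 eexists; split; last exact: HG; rewrite /= Ez.
rewrite /=; case E: (bstep _ b) => [z|] //= -[<-] HG.
by apply/cBitP; exists z => //; apply: HG.
Qed.

Lemma cSet0_refines e1 e2 e3 G b : refines e1 e2 e3 G (cSet 0) (kstep (Num Size b) tsep).
Proof.
split=> [[p [Ep [x [Ex HG]]]]|s].
  have {}Ep : p + 1 = e1 3 by [].
  have {}Ex : x = 0 by [].
  by do 2 eexists; split; last exact: HG; rewrite /= -Ep addn1 Ex.
rewrite /=; case E: (e1 3) => [|p] //= -[<-] HG.
exists p; split; first by suff: p + 1 = e1 3 by []; rewrite addn1.
by exists 0; split=> //; apply: HG.
Qed.

Lemma cSet1_refines e1 e2 e3 G b : refines e1 e2 e3 G (cSet 1) (kstep (Num Root b) tsep).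
Proof.
split=> [[p [Ep [x [Ex HG]]]]|s].
  have {}Ep : p + 1 = e1 3 by [].
  have {}Ex : x = 0 by [].
  by do 2 eexists; split; last exact: HG; rewrite /= -Ep addn1 Ex.
rewrite /=; case E: (e1 3) => [|p] //= -[<-] HG.
exists p; split; first by suff: p + 1 = e1 3 by []; rewrite addn1.
by exists 0; split=> //; apply: HG.
Qed.

Lemma kstepP q a : isK q -> nxt q a <> Bad ->
  (q = Body /\ a = tlp) \/
  [/\ out q a = enc_ctx (kctx q a), isK (nxt q a) &
     forall e1 e2 e3 G, refines e1 e2 e3 G (kctx q a) (kstep q a)].
Proof.
case: q => [[] b|||] // _.
- case: a; try by case: b.
  + by case: b => // _; right; split=> // *; apply: cBit_refines.
  + by case: b => // _; right; split=> // *; apply: cBit_refines.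
  + by case: b => // _; right; split=> // *; apply: cSet0_refines.
- case: a; try by case: b.
  + by case: b => // _; right; split=> // *; apply: cBit_refines.
  + by case: b => // _; right; split=> // *; apply: cBit_refines.
  + by case: b => // _; right; split=> // *; apply: cSet1_refines.
- by case: a => // _; do ?[by left]; right; split=> // *; apply: cBody_refines.
Qed.

(** * Correctness on structures *)

(** Dependent choice: a successor inside [R] is chosen for each pair of a time and a world, and
    iteration from [r] never leaves [R]. *)
Lemma path_of_relation (R E Q : nat -> nat -> Prop) r :
  R 0 r -> (forall i v, R i v -> Q i v /\ exists w, R i.+1 w /\ E v w) ->
  exists pi : nat -> nat, pi 0 = r /\ forall i, Q i (pi i) /\ E (pi i) (pi i.+1).
Proof.
move=> R0 HR.
have step (c : nat * nat) : exists w, R c.1 c.2 -> R c.1.+1 w /\ E c.2 w.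
  (* [choice] needs a witness everywhere; outside [R] the default 0 satisfies the implication. *)
  have [Rc|nRc] := pselect (R c.1 c.2); last by exists 0.
  by have [_ [w Hw]] := HR _ _ Rc; exists w.
have [g Hg] := choice step.
pose pi := fix pi i := if i is j.+1 then g (j, pi j) else r.
have Rpi i : R i (pi i) by elim: i => [//|i Ri]; case: (Hg (i, pi i) Ri).
exists pi; split=> // i; split; first by case: (HR _ _ (Rpi i)).
by case: (Hg (i, pi i) (Rpi i)).
Qed.

Section Final.
Variables (e1 : env1) (e2 : env2) (e3 : env3).
Local Notation D := (fun u v => e2 0 2 [:: u; v]).

Lemma okFP : tsat3 e1 e2 e3 okF <-> kok (stOf e1 e2).
Proof.
have -> : tsat3 e1 e2 e3 okF <-> e1 2 = e1 0 + e1 0 /\ (e1 3 = 0 /\ (e1 1 < e1 0 /\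
    forall w, w < e1 0 -> exists v, v < e1 0 /\ D w v)).
  apply: tsat3_And => //; apply: tsat3_And => //; apply: tsat3_And (ltFP _ _ _ _ _) _.
  apply: tsat3_All1 => w; apply: tsat3_imp (ltFP _ _ _ _ _) _.
  by apply: tsat3_Ex1 => v; apply: tsat3_And (ltFP _ _ _ _ _) _.
by split=> [[? [? []]]|[]].
Qed.

Lemma pathFP t : e2 2 2 = rel_trace t ->
  tsat3 e1 e2 e3 pathF <-> kteam (stOf e1 e2) t.
Proof.
move=> Et.
have -> : tsat3 e1 e2 e3 pathF <-> exists R : nat -> nat -> Prop, R 0 (e1 1) /\
    forall i v, R i v -> v < e1 0 /\ ((forall p, t i p <-> D (e1 0 + v) p.+1) /\
      exists w, R i.+1 w /\ D v w).
  apply: tsat3_Ex2_rel => R; apply: tsat3_And => //.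
  apply: tsat3_All1 => i; apply: tsat3_All1 => v; apply: tsat3_imp => //.
  apply: tsat3_And (ltFP _ _ _ _ _) _; apply: tsat3_And.
    apply: tsat3_All1 => p; apply: tsat3_iff; first by rewrite /= /upd2 /= Et.
    by rewrite /= addn1.
  apply: tsat3_Ex1 => w; apply: tsat3_And => //.
  by rewrite /= addn1.
split=> [[R [R0 HR]]|[pi [pi0 Hpi]]].
  apply: (@path_of_relation R D (fun i v => v < e1 0 /\
    forall p, t i p <-> D (e1 0 + v) p.+1)) => // i v /HR[? [? ?]]; split=> //.
(* Conversely, the graph of a path is such a relation. *)
exists (fun i v => v = pi i); split=> // i v ->.
by have [[? ?] ?] := Hpi i; do 2 split=> //; exists (pi i.+1).
Qed.

End Final.

Lemma teamFP e1 e2 e3 :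
  tsat3 e1 e2 e3 teamF <-> teamOf (e3 0 [:: 2]) = kteam (stOf e1 e2).
Proof.
have -> : tsat3 e1 e2 e3 teamF <->
    forall t, teamOf (e3 0 [:: 2]) t <-> kteam (stOf e1 e2) t.
  apply: tsat3_All2_trace => t; apply: tsat3_iff => //.
  exact: (@pathFP e1 (upd2 e2 2 2 (rel_trace t))).
by split=> [E|->//]; apply/funext=> t; rewrite propeqE.
Qed.

Lemma cFinalP e1 e2 e3 f :
  tsat3 e1 e2 e3 (plug cFinal (tr f)) <->
  kok (stOf e1 e2) /\ tsat (kteam (stOf e1 e2)) f.
Proof.
split=> [[/okFP Hok [A [/teamFP EA /tsat3_tr]]]|[Hok Hf]].
  by move=> Hf; split; [exact: Hok|rewrite -EA; exact: Hf].
split; first exact/okFP.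
exists (ofTeam (kteam (stOf e1 e2))); split.
  by apply/teamFP; rewrite [upd3 _ _ _ _ _ _]/= ofTeamK.
by apply/tsat3_tr; rewrite [upd3 _ _ _ _ _ _]/= ofTeamK.
Qed.

Fixpoint krun (q : tstate) (s : kstate) (w : seq tok) : option (tstate * kstate) :=
  if w is a :: w' then
    if kstep q a s is Some s' then krun (nxt q a) s' w' else None
  else Some (q, s).

Lemma krun_cons q s a w s' : kstep q a s = Some s' ->
  krun q s (a :: w) = krun (nxt q a) s' w.
Proof. by move=> /= ->. Qed.

Lemma krun_cons_None q s a w : kstep q a s = None -> krun q s (a :: w) = None.
Proof. by move=> /= ->. Qed.

Lemma krun_cat q s u w :
  krun q s (u ++ w) = obind (fun c => krun c.1 c.2 w) (krun q s u).
Proof. by elim: u q s => //= a u IHu q s; case: kstep. Qed.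

Lemma krun_bad s w q s' : krun Bad s w = Some (q, s') -> q = Bad.
Proof. by case: w => [[]|]. Qed.

Lemma parse_output q w F : isK q -> output q w = enc_tform F ->
  exists w1 f, w = w1 ++ tlp :: enc_ltl f /\
    forall e1 e2 e3, tsat3 e1 e2 e3 F ->
    exists s, [/\ krun q (stOf e1 e2) w1 = Some (Body, s), kok s & tsat (kteam s) f].
Proof.
elim: w q F => [|a w IHw] q F Kq; first by case: F.
have [Ebad|Nbad] := pselect (nxt q a = Bad).
  by rewrite output_cons nxt_bad //= -[enc_tform F]cats0 => /not_tform_sep.
case: (kstepP Kq Nbad) => [[-> ->]|[Eo Kn Href]]; rewrite output_cons.
  rewrite -[enc_tform F]cats0 => /(@parse_plug cFinal)[G ->] /parse_form[f [s [-> -> Es]]].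
  (* Every token outputs a nonempty word, so nothing can remain unread. *)
  have -> : s = [::] by case: s Es => // b s; rewrite output_cons; case: b.
  exists [::], f; rewrite cats0; split=> // e1 e2 e3 /cFinalP[Hok Hf].
  by exists (stOf e1 e2).
rewrite Eo -[enc_tform F]cats0 => /parse_plug[G ->]; rewrite cats0 => E.
have [w1 [f [-> Hf]]] := IHw _ _ Kn E.
exists (a :: w1), f; split=> // e1 e2 e3 /(proj1 (Href _ _ _ _))[e1' [e2' [Es]]].
by move=> /Hf[s [Hr Hok Hs]]; exists s; split=> //=; rewrite Es.
Qed.

Definition DK (K : KS) (u v : nat) : Prop :=
  (u < kn K /\ kedge K u v) \/
  (kn K <= u /\ exists2 p, p \in klabel K (u - kn K) & v = p.+1).

Lemma kteam_DK K i x : (forall row, row \in kR K -> size row = kn K) ->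
  size (kR K) = kn K -> kroot K < kn K ->
  kteam (KState (kn K) (kroot K) i x (DK K)) = teamK K.
Proof.
move=> Hrow HR Hr.
have edge_lt w v : kedge K w v -> v < kn K.
  rewrite /kedge; case: (ltnP w (size (kR K))) => Hw; last first.
    by rewrite [nth [::] _ _]nth_default // nth_nil.
  case: (ltnP v (kn K)) => // Hv; rewrite nth_default //.
  by rewrite Hrow // mem_nth.
have Dedge w v : w < kn K -> DK K w v <-> kedge K w v.
  by move=> Hw; split=> [[[]|[]]//|]; [lia|left].
have Dlab w p : DK K (kn K + w) p.+1 <-> p \in klabel K w.
  rewrite /DK addKn; split=> [[[]|[_ [q Hq [->]]]]//|Hp]; first lia.
  by right; split; [rewrite leq_addr|exists p].
apply/funext=> t; rewrite propeqE; split=> -[pi].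
  case=> pi0 Hpi; exists pi; split=> //; split=> [k|]; first by case: (Hpi k) => -[].
  split=> [k|]; first by case: (Hpi k) => -[Hk _] /(Dedge _ _ Hk).
  apply/funext=> k; apply/funext=> p; case: (Hpi k) => -[_ Ht] _.
  by apply/idP/idP=> [/Ht/Dlab|/Dlab/Ht].
case=> pi0 [Hlt [Hedge ->]]; exists pi; split=> // k.
split; last exact/(Dedge _ _ (Hlt k)).
by split=> [|p]; [exact: Hlt|exact: iff_sym (Dlab _ _)].
Qed.

Lemma eqD (D D' : nat -> nat -> Prop) : (forall u v, D u v <-> D' u v) -> D = D'.
Proof. by move=> E; apply/funext=> u; apply/funext=> v; rewrite propeqE. Qed.

(** * The run on the encoding of a structure *)

Section Forward.
Variables (n r : nat).

Lemma krun_num q s bs z w : q = Size \/ q = Root -> bfold (sx s) bs = Some z ->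
  krun (Num q (cls (sx s))) s (map enc_bit bs ++ w) = krun (Num q (cls z)) (setX s z) w.
Proof.
move=> Hq; elim: bs s => [|b bs IHbs] s; first by move=> [<-]; case: s.
rewrite bfold_cons; case E: (bstep _ b) => [y|//] Ez.
have Ek : kstep (Num q (cls (sx s))) (enc_bit b) s = Some (setX s y).
  by case: Hq => ->; case: b E => /= ->.
rewrite map_cons cat_cons (krun_cons _ Ek) (nxt_bit _ E).
exact: (IHbs (setX s y)).
Qed.

Lemma krun_row i x D row w : i < n -> x + size row <= n ->
  krun Body (KState n r i x D) (map enc_bit row ++ w)
  = krun Body (KState n r i (x + size row)
      (fun u v => D u v \/ (u = i /\ x <= v /\ nth false row (v - x)))) w.
Proof.
move=> Hi; elim: row x D => [|b row IHrow] x D Hx.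
  congr (krun _ (KState _ _ _ _ _) _); first by rewrite addn0.
  by apply: eqD => u v; rewrite nth_nil; split=> [|[|[_ []]]//]; left.
rewrite /= in Hx.
have Ek : kstep Body (enc_bit b) (KState n r i x D)
    = Some (KState n r i x.+1 (if b then addD D i x else D)).
  by case: b => /=; rewrite Hi; case: ifP => //; lia.
have En : nxt Body (enc_bit b) = Body by case: (b).
rewrite map_cons cat_cons (krun_cons _ Ek) En IHrow; last lia.
congr (krun _ (KState _ _ _ _ _) _); first by rewrite /=; lia.
apply: eqD => u v.
have nf : ~ is_true false by [].
have -> : (if b then addD D i x else D) u v <-> D u v \/ (u = i /\ v = x /\ b).
  by have tt : is_true true by []; rewrite /addD; case: (b) => /=; tauto.
(* Later columns belong to the rest of the row, earlier ones are untouched, and column [x] holds the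
   digit just read. *)
case: (ltngtP x v) => Hv.
- have -> : v - x = (v - x.+1).+1 by lia.
  by have : v <> x by [lia]; rewrite /=; tauto.
- by have : v <> x by [lia]; tauto.
- by rewrite -Hv subnn /=; have : is_true true by []; tauto.
Qed.

Definition rowsEnc (rows : seq (seq bool)) : seq tok :=
  flatten [seq map enc_bit row ++ [:: tsep] | row <- rows].
Definition labsEnc (ls : seq (seq nat)) : seq tok :=
  flatten [seq flatten (map binsep l) ++ [:: trp] | l <- ls].

Lemma krun_rows i D (rows : seq (seq bool)) w : i + size rows <= n ->
  (forall row : seq bool, row \in rows -> size row = n) ->
  krun Body (KState n r i 0 D) (rowsEnc rows ++ w)
  = krun Body (KState n r (i + size rows) 0
      (fun u v => D u v \/ (i <= u /\ nth false (nth [::] rows (u - i)) v))) w.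
Proof.
elim: rows i D => [|row rows IHrows] i D Hi Hs.
  congr (krun _ (KState _ _ _ _ _) _); first by rewrite addn0.
  by apply: eqD => u v; rewrite !nth_nil; split=> [|[|[]]//]; left.
have Hrow : size row = n by apply: Hs; rewrite mem_head.
rewrite /= in Hi; rewrite /rowsEnc /= -!catA krun_row; [|lia|by rewrite add0n Hrow].
have lt_in : i < n by lia.
rewrite /= lt_in add0n Hrow eqxx -/(rowsEnc rows) IHrows; last first.
- by move=> x Hx; apply: Hs; rewrite in_cons Hx orbT.
- lia.
congr (krun _ (KState _ _ _ _ _) _); first by rewrite /=; lia.
apply: eqD => u v; have nf : ~ is_true false by [].
have tt : is_true true by [].
case: (ltngtP i u) => Hu.
- have -> : u - i = (u - i.+1).+1 by lia.
  by have : u <> i by [lia]; rewrite /=; tauto.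
- by have : u <> i by [lia]; tauto.
- by rewrite -Hu subnn /= subn0; tauto.
Qed.

Lemma krun_bits i x D bs z w : n <= i -> bfold x bs = Some z ->
  krun Body (KState n r i x D) (map enc_bit bs ++ w) = krun Body (KState n r i z D) w.
Proof.
move=> Hi; elim: bs x => [|b bs IHbs] x; first by move=> [<-].
rewrite bfold_cons; case E: (bstep _ b) => [y|//] Ez.
have Ek : kstep Body (enc_bit b) (KState n r i x D) = Some (KState n r i y D).
  by case: b E => /= ->; rewrite ltnNge Hi.
have En : nxt Body (enc_bit b) = Body by case: (b).
by rewrite map_cons cat_cons (krun_cons _ Ek) En; apply: IHbs.
Qed.

Lemma krun_label i D l w : n <= i < n + n ->
  krun Body (KState n r i 0 D) (flatten (map binsep l) ++ w)
  = krun Body (KState n r i 0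
      (fun u v => D u v \/ (u = i /\ exists2 p, p \in l & v = p.+1))) w.
Proof.
move=> /andP[Hi Hi2]; elim: l D => [|p l IHl] D.
  by congr (krun _ (KState _ _ _ _ _) _); apply: eqD => u v; split=> [|[|[_ []]]//]; left.
rewrite /= /binsep -enc_bits -!catA (krun_bits _ _ Hi (bfold_bits p)) /=.
rewrite ltnNge Hi Hi2 /= IHl; congr (krun _ (KState _ _ _ _ _) _).
apply: eqD => u v; split=> [[[|[-> ->]]|[-> [q Hq ->]]]|[|[-> [q]]]].
- by left.
- by right; split=> //; exists p; rewrite ?mem_head.
- by right; split=> //; exists q; rewrite // in_cons Hq orbT.
- by left; left.
rewrite in_cons => /orP[/eqP->|Hq] ->; first by left; right.
by right; split=> //; exists q.
Qed.

Lemma krun_labels i D ls w : n <= i -> i + size ls <= n + n ->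
  krun Body (KState n r i 0 D) (labsEnc ls ++ w)
  = krun Body (KState n r (i + size ls) 0
      (fun u v => D u v \/ (i <= u /\ exists2 p, p \in nth [::] ls (u - i) & v = p.+1))) w.
Proof.
elim: ls i D => [|l ls IHls] i D Hi Hi2.
  congr (krun _ (KState _ _ _ _ _) _); first by rewrite addn0.
  by apply: eqD => u v; rewrite nth_nil; split=> [|[|[_ []]]//]; left.
rewrite /= in Hi2; rewrite /labsEnc /= -!catA krun_label; last lia.
rewrite /= Hi /= -/(labsEnc ls) IHls; [|lia|lia].
congr (krun _ (KState _ _ _ _ _) _); first by rewrite /=; lia.
apply: eqD => u v; have nf : ~ is_true false by [].
have tt : is_true true by [].
case: (ltngtP i u) => Hu.
- have -> : u - i = (u - i.+1).+1 by lia.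
  by have : u <> i by [lia]; rewrite /=; tauto.
- by have : u <> i by [lia]; tauto.
- by rewrite -Hu subnn /=; tauto.
Qed.

End Forward.

Lemma krun_enc_KS K n0 r0 : size (kR K) = kn K ->
  (forall row, row \in kR K -> size row = kn K) -> size (klab K) = kn K ->
  krun (Num Size Start) (KState n0 r0 0 0 (fun _ _ => False)) (enc_KS K)
  = Some (Body, KState (kn K) (kroot K) (kn K + kn K) 0 (DK K)).
Proof.
move=> HR Hrow HL.
rewrite /enc_KS /binsep -!enc_bits -!catA.
have sepS p s w : krun (Num Size (cls p.+1)) (setX s p.+1) ([:: tsep] ++ w)
    = krun (Num Root (cls 0)) (KState p (sr s) (si s) 0 (sD s)) w by case: p.
have sepR p s w : krun (Num Root (cls p.+1)) (setX s p.+1) ([:: tsep] ++ w)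
    = krun Body (KState (sn s) p (si s) 0 (sD s)) w by case: p.
pose s0 := KState n0 r0 0 0 (fun _ _ => False).
rewrite (@krun_num Size s0 _ _ _ (or_introl erefl) (bfold_bits (kn K))) sepS.
rewrite (@krun_num Root (KState _ _ _ 0 _) _ _ _ (or_intror erefl) (bfold_bits (kroot K))).
rewrite sepR [sn _]/= [si _]/= [sD _]/=.
rewrite krun_rows //; last by rewrite HR.
rewrite -[flatten _]cats0 krun_labels; [|by rewrite HR|by rewrite HR HL].
rewrite /= HR HL add0n; congr (Some (_, KState _ _ _ _ _)).
apply: eqD => u v; rewrite /DK /klabel subn0.
split=> [[[//|[_ He]]|[Hu Hl]]|[[Hu He]|[Hu Hl]]].
(* Beyond the last row [nth] returns the empty row, so an edge forces [u < kn K]. *)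
- left; split=> //; case: (ltnP u (kn K)) => // Hu; move: He.
  by rewrite [nth [::] _ _]nth_default ?HR // nth_nil.
- by right.
- by left; right.
- by right.
Qed.

(** * Recovering the structure from a run *)

Lemma krun_num_inv q b s w s' : q = Size \/ q = Root ->
  krun (Num q b) s w = Some (Body, s') ->
  exists bs p u s1, [/\ w = map enc_bit bs ++ tsep :: u, bfold (sx s) bs = Some p.+1,
    kstep (Num q Nonzero) tsep (setX s p.+1) = Some s1 &
    krun (nxt (Num q Nonzero) tsep) s1 u = Some (Body, s')].
Proof.
move=> Hq; elim: w b s => [|a w IHw] b s; first by [].
have bit c : krun (Num q b) s (enc_bit c :: w) = Some (Body, s') ->
    exists bs p u s1, [/\ enc_bit c :: w = map enc_bit bs ++ tsep :: u,
      bfold (sx s) bs = Some p.+1,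
      kstep (Num q Nonzero) tsep (setX s p.+1) = Some s1 &
      krun (nxt (Num q Nonzero) tsep) s1 u = Some (Body, s')].
  have Ek : kstep (Num q b) (enc_bit c) s = omap (setX s) (bstep (sx s) c).
    by case: Hq => ->; case: c.
  case E: (bstep (sx s) c) => [z|]; last by rewrite krun_cons_None // Ek E.
  rewrite (krun_cons _ (s' := setX s z)) ?Ek ?E //.
  have [[b' ->]|->] : (exists b', nxt (Num q b) (enc_bit c) = Num q b') \/
      nxt (Num q b) (enc_bit c) = Bad; last by move/krun_bad.
    by case: Hq => ->; case: (b); case: (c); try (by right); left; eexists.
  move=> /IHw[bs [p [u [s1 [-> Ep Es1 Eu]]]]].
  by exists (c :: bs), p, u, s1; split=> //; rewrite bfold_cons E.
case: a; try by case: Hq => ->.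
- exact: (bit false).
- exact: (bit true).
move=> E; exists [::]; case Ex: (sx s) => [|p]; first by case: Hq E => -> /=; rewrite Ex.
exists p, w; case: Hq E => -> E.
  exists (KState p (sr s) (si s) 0 (sD s)); split=> //.
  (* Only [Start] leads to [Bad] here; the other two values act alike on [tsep], so [Nonzero]
     represents them. *)
  by move: E; rewrite /= Ex; case: (b) => // /krun_bad.
exists (KState (sn s) p (si s) 0 (sD s)); split=> //.
by move: E; rewrite /= Ex; case: (b) => // /krun_bad.
Qed.

(** What the counters reveal about the word [u] read so far: complete rows and an open one, or all
    rows, the closed label lists, the closed labels [l] of the open list and the digits [bs] of the
    open numeral. A label is closed only while [i < n + n], whence the last clause. *)
Definition bodyInv (n : nat) (u : seq tok) (i x : nat) : Prop :=
  exists rows, (forall row, row \in rows -> size row = n) /\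
  if i < n then exists cur,
    [/\ u = rowsEnc rows ++ map enc_bit cur, size rows = i, size cur = x & x <= n]
  else exists labs l bs, [/\ u = rowsEnc rows ++ labsEnc labs ++
      flatten (map binsep l) ++ map enc_bit bs,
    size rows = n, size labs = i - n, bfold 0 bs = Some x & l = [::] \/ i < n + n].

Lemma rowsEnc_rcons rows row :
  rowsEnc (rcons rows row) = rowsEnc rows ++ map enc_bit row ++ [:: tsep].
Proof. by rewrite /rowsEnc map_rcons flatten_rcons. Qed.

Lemma labsEnc_rcons labs l :
  labsEnc (rcons labs l) = labsEnc labs ++ flatten (map binsep l) ++ [:: trp].
Proof. by rewrite /labsEnc map_rcons flatten_rcons. Qed.

Lemma krun_body_state s w q s' : krun Body s w = Some (q, s') -> q = Body.
Proof.
elim: w s => [|a w IHw] s /=; first by case.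
by case: s => n r i x D; case: a => //=; case: (if _ then _ else _) => //; eauto.
Qed.

Lemma bodyInv_bit n r i x D b s u : bodyInv n u i x ->
  bitStep (KState n r i x D) b = Some s ->
  [/\ sn s = n, sr s = r & bodyInv n (rcons u (enc_bit b)) (si s) (sx s)].
Proof.
case=> rows [Hs H]; rewrite /bitStep; move: H; case: ltnP => Hi.
  case=> cur [-> Er Ec Hx]; case: ltnP => // Hx' [<-]; split=> //=.
  exists rows; split=> //; rewrite Hi; exists (rcons cur b).
  by rewrite map_rcons -rcons_cat size_rcons Ec.
case=> labs [l [bs [-> Er El Eb Hl]]].
case E: (bstep x b) => [z|] //= [<-]; split=> //=.
exists rows; split=> //; rewrite ltnNge Hi; exists labs, l, (rcons bs b).
by rewrite map_rcons -!rcons_cat bfold_rcons Eb.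
Qed.

Lemma bodyInv_step n r i x D a s u : bodyInv n u i x ->
  bodyStep (KState n r i x D) a = Some s ->
  [/\ sn s = n, sr s = r & bodyInv n (rcons u a) (si s) (sx s)].
Proof.
move=> Hinv; case: a => //.
- exact: (bodyInv_bit (b := false)).
- exact: (bodyInv_bit (b := true)).
- case: Hinv => rows [Hs H]; rewrite /bodyStep; move: H; case: ltnP => Hi.
    case=> cur [-> Er Ec Hx]; case: eqP => // Ex [<-]; split=> //=.
    exists (rcons rows cur); split.
      by move=> row; rewrite mem_rcons in_cons => /orP[/eqP->|/Hs//]; rewrite Ec.
    have E : rcons (rowsEnc rows ++ map enc_bit cur) tsep = rowsEnc (rcons rows cur).
      by rewrite rowsEnc_rcons -cats1 catA.
    (* If the row just closed is the last one, the label phase starts with nothing read. *)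
    case: ltnP => Hi1; first by exists [::]; rewrite E cats0 size_rcons Er.
    exists [::], [::], [::]; rewrite E !cats0 size_rcons Er; split=> //; last by left.
      lia.
    by rewrite /=; lia.
  case=> labs [l [bs [-> Er El Eb Hl]]].
  case: ifP => // /andP[x_gt0 Hi2] [<-]; split=> //=.
  case: x x_gt0 Eb => // p _ /bfold_inv->.
  exists rows; split=> //; rewrite ltnNge Hi; exists labs, (rcons l p), [::].
  rewrite map_rcons flatten_rcons cats0 enc_bits; split=> //; last by right.
  by rewrite -cats1 -!catA.
- case: Hinv => rows [Hs H]; rewrite /bodyStep; move: H; case: ltnP => //= Hi.
  case=> labs [l [bs [-> Er El Eb Hl]]].
  case: eqP => // Ex [<-]; split=> //=.
  exists rows; split=> //; rewrite ltnNge leqW //; exists (rcons labs l), [::], [::].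
  rewrite Ex in Eb; rewrite (bfold_eq0 Eb) labsEnc_rcons size_rcons El.
  split=> //; last by left.
    by rewrite -cats1 -!catA.
  lia.
Qed.

Lemma bodyInv_run s0 w s : si s0 = 0 -> sx s0 = 0 -> krun Body s0 w = Some (Body, s) ->
  [/\ sn s = sn s0, sr s = sr s0 & bodyInv (sn s0) w (si s) (sx s)].
Proof.
move=> Hi Hx; elim/last_ind: w s => [|w a IHw] s.
  move=> [<-]; rewrite Hi Hx; split=> //; exists [::]; split=> //.
  case: ltnP => Hn; first by exists [::].
  by exists [::], [::], [::]; split=> //=; [lia|left].
rewrite -cats1 krun_cat; case E: (krun Body s0 w) => [[q s1]|] //=.
have Eq := krun_body_state E; subst q.
have [E1 E2 Hinv] := IHw _ E.
rewrite /=; case Es: (bodyStep s1 a) => [s2|] // [_ <-].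
case: s1 E E1 E2 Hinv Es => n r i x D E E1 E2 Hinv.
rewrite /= in E1 E2; rewrite -E1 -E2 cats1 /= in Hinv * => /bodyInv_step; exact.
Qed.

Lemma krun_inv n0 r0 w s :
  krun (Num Size Start) (KState n0 r0 0 0 (fun _ _ => False)) w = Some (Body, s) ->
  kok s -> exists K, [/\ w = enc_KS K, wfKS K & kteam s = teamK K].
Proof.
move=> E Hok; have E0 := E; move: E => /(krun_num_inv (or_introl erefl)).
case=> bs [n [u [s1 [Ew /bfold_inv Ebs [<-] /=]]]].
move=> /(krun_num_inv (or_intror erefl))[bs' [r [u' [s2 [Eu /bfold_inv Ebs' [<-] /=]]]]].
move=> /bodyInv_run[] // /= En Er [rows [Hrows]].
case: (Hok) => Ei Ex Hr _; rewrite Ei En.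
have -> : (n + n < n) = false by lia.
case=> labs [l [cs [Eu' Hrs Hls Ecs Hl]]].
have {}Hl : l = [::] by case: Hl => //; lia.
rewrite Ex in Ecs; pose K := Build_KS n rows labs r.
have Hlab : size (klab K) = kn K by rewrite /= Hls; lia.
have EK : w = enc_KS K.
  rewrite Ew Eu Eu' Hl (bfold_eq0 Ecs) /= !cats0 Ebs Ebs' /enc_KS /binsep !enc_bits.
  by rewrite -!catA.
(* The collected relation is not traced backwards: once the word is known to be [enc_KS K], the
   forward run on it determines the final state. *)
have Es : s = KState (kn K) (kroot K) (kn K + kn K) 0 (DK K).
  by move: E0; rewrite EK krun_enc_KS // => -[<-].
have Hr' : kroot K < kn K by rewrite /= -En -Er.
exists K; split=> //; last by rewrite Es kteam_DK.
split; first by rewrite (leq_ltn_trans _ Hr').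
do 4! [split=> //]; move=> v Hv; case: Hok; rewrite Es /= => _ _ _ /(_ _ Hv)[v' [Hv' HD]].
by exists v'; split=> //; case: HD => [[]|[]] //; rewrite leqNgt Hv.
Qed.

(** * Closedness and the reduction *)

Definition scope := (seq nat * seq (nat * nat) * seq (nat * seq nat))%type.

Definition good (b : scope) (F : tform) : bool := closed_in b.1.1 b.1.2 b.2 F && wt F.

(** A partial computation of the scope in the hole, so that closedness and typing of each fixed
    context are checked by evaluation. *)
Definition frame_scope (b : scope) (c : frame) : option scope :=
  let: (b1, b2, b3) := b in
  match c with
  | KE1 i | KA1 i => Some (i :: b1, b2, b3)
  | KE2 i n | KA2 i n => Some (b1, (i, n) :: b2, b3)
  | KE3 j ty => Some (b1, b2, (j, ty) :: b3)
  | KNot => Some b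
  | KAnd F | KOr F => if good b F then Some b else None
  end.
Fixpoint ctx_scope (b : scope) (c : seq frame) : option scope :=
  if c is a :: c' then obind (ctx_scope^~ c') (frame_scope b a) else Some b.

Lemma good_plug b c b' G : ctx_scope b c = Some b' -> good b' G -> good b (plug c G).
Proof.
elim: c b => [|a c IHc] b /=; first by move=> [->].
case E: (frame_scope b a) => [b''|] //= /IHc H /H; move: E.
case: b => [[b1 b2] b3]; case: a => [i|i|i n|i n|j ty||F|F] /=.
1-6: by move=> [<-].
- by case: ifP => // /andP[/= ? ?] [<-] /andP[? ?]; apply/andP; split; apply/andP.
- by case: ifP => // /andP[/= ? ?] [<-] /andP[? ?]; apply/andP; split; apply/andP.
Qed.

Definition subscope (b b' : scope) : bool :=
  [&& all (mem b'.1.1) b.1.1, all (mem b'.1.2) b.1.2 & all (mem b'.2) b.2].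

(** Weakening: contexts leave extra names in scope, while facts about subformulas are stated for the
    smallest scope. *)
Lemma good_sub b b' F : subscope b b' -> good b F -> good b' F.
Proof.
case: b b' => [[b1 b2] b3] [[c1 c2] c3] /and3P[/= /allP S1 /allP S2 /allP S3].
rewrite /good /= => /andP[H ->]; rewrite andbT.
have all_sub (T : eqType) (l l' : seq T) (P Q : pred T) : {subset P <= Q} -> all P l -> all Q l.
  by move=> PQ /allP H'; apply/allP => x /H'; apply: PQ.
have ext (T : eqType) (x : T) (l l' : seq T) : {subset l <= l'} -> {subset x :: l <= x :: l'}.
  by move=> S y; rewrite !in_cons => /orP[->//|/S->]; rewrite orbT.
elim: F b1 b2 b3 c1 c2 c3 S1 S2 S3 H => //=.
- by move=> x y b1 b2 b3 c1 c2 c3 S1 S2 S3; apply: all_sub.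
- by move=> x y b1 b2 b3 c1 c2 c3 S1 S2 S3; apply: all_sub.
- move=> i n ts b1 b2 b3 c1 c2 c3 S1 S2 S3 /andP[/S2 -> /=]; exact: all_sub.
- move=> i n ts b1 b2 b3 c1 c2 c3 S1 S2 S3 /andP[/S3 -> /=]; exact: all_sub.
- by move=> F IH F' IH' b1 b2 b3 c1 c2 c3 S1 S2 S3 /andP[/(IH _ _ _ _ _ _ S1 S2 S3)->];
    apply: IH'.
- by move=> F IH F' IH' b1 b2 b3 c1 c2 c3 S1 S2 S3 /andP[/(IH _ _ _ _ _ _ S1 S2 S3)->];
    apply: IH'.
- by move=> i F IH b1 b2 b3 c1 c2 c3 S1 S2 S3; apply: IH => //; apply: ext.
- by move=> i F IH b1 b2 b3 c1 c2 c3 S1 S2 S3; apply: IH => //; apply: ext.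
- by move=> i n F IH b1 b2 b3 c1 c2 c3 S1 S2 S3; apply: IH => //; apply: ext.
- by move=> i n F IH b1 b2 b3 c1 c2 c3 S1 S2 S3; apply: IH => //; apply: ext.
- by move=> i n F IH b1 b2 b3 c1 c2 c3 S1 S2 S3; apply: IH => //; apply: ext.
- by move=> i n F IH b1 b2 b3 c1 c2 c3 S1 S2 S3; apply: IH => //; apply: ext.
Qed.

Lemma good_And b F G : good b F -> good b G -> good b (FAnd F G).
Proof. by move=> /andP[cF wF] /andP[cG wG]; rewrite /good /= cF cG wF wG. Qed.

Lemma good_Or b F G : good b F -> good b G -> good b (FOr F G).
Proof. by move=> /andP[cF wF] /andP[cG wG]; rewrite /good /= cF cG wF wG. Qed.

Lemma good_bits bs b2 b3 b1 : 3 \in b1 -> (0, [:: 2]) \in b3 ->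
  good (b1, b2, b3) (plug (flatten (map cBit bs)) atomF).
Proof.
move=> H3 H0; apply: (@good_sub ([:: 3], [::], [:: (0, [:: 2])])).
  by rewrite /subscope /= H3 H0.
elim: bs => [//|b bs IHbs].
have -> : plug (flatten (map cBit (b :: bs))) atomF
    = plug (cBit b) (plug (flatten (map cBit bs)) atomF) by rewrite -plug_cat.
apply: (@good_plug _ _ ([:: 3; 5; 3], [::], [:: (0, [:: 2])])); first by case: (b).
exact: good_sub IHbs.
Qed.

Lemma good_tr f : good ([::], [::], [:: (0, [:: 2])]) (tr f).
Proof.
elim: f => [p|g IHg|g IHg h IHh|g IHg h IHh|g IHg|g IHg|g IHg
  |g IHg h IHh|g IHg h IHh|g IHg].
- rewrite /= -/(cat _ _); apply: (@good_plug _ cZero) => //; exact: good_bits.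
- by apply: (@good_plug _ cNeg) => //; apply: good_sub IHg.
- exact: good_And.
- apply: (@good_plug _ cOr1) => //; apply: good_And; last exact: good_sub IHh.
  by apply: (@good_plug _ cOr2) => //; apply: good_sub IHg.
- by apply: (@good_plug _ (cShift AOne)) => //; apply: good_sub IHg.
- by apply: (@good_plug _ (KE1 8 :: cShift (V 8))) => //; apply: good_sub IHg.
- by apply: (@good_plug _ (KA1 8 :: cShift (V 8))) => //; apply: good_sub IHg.
- apply: (@good_plug _ cU1) => //; apply: good_And; last exact: good_sub IHh.
  by apply: (@good_plug _ cU2) => //; apply: good_sub IHg.
- apply: (@good_plug _ cR1) => //; apply: good_Or; last exact: good_sub IHh.
  by apply: (@good_plug _ cR2) => //; apply: good_sub IHg.
- by apply: (@good_plug _ [:: KNot]) => //; apply: good_sub IHg.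
Qed.

Definition Kscope : scope := ([:: 0; 1; 2; 3], [:: (0, 2)], [::]).

Lemma good_kctx q a G : isK q -> nxt q a <> Bad -> good Kscope G ->
  good Kscope (plug (kctx q a) G).
Proof.
move=> Hq Hn HG.
suff [b Eb Sb] : exists2 b, ctx_scope Kscope (kctx q a) = Some b & subscope Kscope b.
  by apply: good_plug Eb _; apply: good_sub HG.
by case: q Hq Hn => [[] b|||] // _; case: a => //= _; eexists; try reflexivity.
Qed.

(** Each token wraps its chain around the formula built from the rest of the word. Truth in all
    environments representing the state is what the second half of [refines] asks of that
    formula. *)
Lemma output_complete q w s s' f : isK q -> krun q s w = Some (Body, s') ->
  kok s' -> tsat (kteam s') f ->
  exists F, [/\ output q (w ++ tlp :: enc_ltl f) = enc_tform F, good Kscope F &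
    forall e1 e2 e3, stOf e1 e2 = s -> tsat3 e1 e2 e3 F].
Proof.
move=> Kq; elim: w q s Kq => [|a w IHw] q s Kq.
  move=> [-> ->] Hok Hf; exists (plug cFinal (tr f)); split.
  - rewrite [_ ++ _]/= output_cons -[enc_ltl f]cats0 output_ltl enc_plug.
    by rewrite /output /= cats0.
  - by apply: (@good_plug _ cFinal) => //; apply: good_sub (good_tr f).
  - by move=> e1 e2 e3 E; apply/cFinalP; rewrite E.
rewrite cat_cons output_cons /=; case E: (kstep q a s) => [s1|] // Hr Hok Hf.
have Nbad : nxt q a <> Bad by move=> Eb; rewrite Eb in Hr; have := krun_bad Hr.
case: (kstepP Kq Nbad) => [[Eq Ea]|[-> Kn Href]].
  by move: E; rewrite Eq Ea; case: (s).
have [F [-> gF HF]] := IHw _ _ Kn Hr Hok Hf.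
exists (plug (kctx q a) F); split; first by rewrite enc_plug.
  exact: good_kctx.
move=> e1 e2 e3 Es; apply: (proj2 (Href e1 e2 e3 F) s1); first by rewrite Es.
by move=> e1' e2' E'; apply: HF.
Qed.

Lemma out_bound : exists L, forall q a, size (out q a) <= L.
Proof.
pose g a := \max_(q : tstate) size (out q a).
(* The maximum over control states is a finite big operator; over tokens it is taken along an
   explicit list. *)
have [L HL] : exists L, forall a, g a <= L.
  exists (foldr maxn 0 (map g [:: t0; t1; tsep; tlp; trp; tAtom; tNeg; tAnd; tOr;
    tX; tF; tG; tU; tR; tSim; tV; tZero; tOne; tPlus; tTimes; tEq; tLe; tSO; tTO;
    tE1; tA1; tE2; tA2; tE3; tA3])).
  by case; rewrite [map _ _]/= [foldr _ _ _]/= !leq_max leqnn ?orbT.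
exists L => q a; apply: leq_trans (HL a).
exact: (@leq_bigmax_cond _ xpredT (fun q => size (out q a))).
Qed.

Definition MC_output (w : seq tok) : seq tok := enc_ctx cInit ++ output (Num Size Start) w.

Lemma tsat3_init_inv e1 e2 e3 F : tsat3 e1 e2 e3 (plug cInit F) ->
  exists e1' e2' n0 r0,
    stOf e1' e2' = KState n0 r0 0 0 (fun _ _ => False) /\ tsat3 e1' e2' e3 F.
Proof.
case=> n0 [r0 [i [Ei [x [Ex [D [_ [HD HF]]]]]]]].
do 2 eexists; exists n0, r0; split; last exact: HF.
rewrite /stOf; congr KState; [exact: Ei|exact: Ex|].
by apply: eqD => u v; split=> //; apply: (HD u v).
Qed.

Lemma tsat3_init e1 e2 e3 F :
  (forall e1' e2', stOf e1' e2' = KState 0 0 0 0 (fun _ _ => False) ->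
    tsat3 e1' e2' e3 F) -> tsat3 e1 e2 e3 (plug cInit F).
Proof.
move=> HF; exists 0, 0, 0; split=> //; exists 0; split=> //.
by exists (fun _ => False); split=> //; split; [move=> u v []|apply: HF].
Qed.

(** From right to left, the output being an encoding splits the word, its truth gives a run ending
    in a state with [kok], and only encodings of well-formed structures have such a run. *)
Lemma MC_outputP w : MC_lang w <-> Delta30_lang (MC_output w).
Proof.
split=> [[K [f [-> [Hwf Hf]]]]|[F [EF [_ [_]]]]].
  have [n_gt0 [HR [Hrow [HL [Hr Hser]]]]] := Hwf.
  have Hrun := krun_enc_KS 0 0 HR Hrow HL.
  have [] := @output_complete (Num Size Start) _ _ _ f isT Hrun.
  - by split=> //= v Hv; have [v' [Hv' He]] := Hser _ Hv; exists v'; split=> //; left.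
  - by rewrite kteam_DK.
  move=> F [EF gF HF]; exists (plug cInit F); split.
    by rewrite enc_plug /MC_output /enc_MC EF.
  have /andP[cF wF] : good ([::], [::], [::]) (plug cInit F).
    by apply: (@good_plug _ cInit) => //; apply: good_sub gF.
  do 2! split=> //; by apply: tsat3_init => e1 e2 E; apply: HF.
move: EF; rewrite /MC_output -[enc_tform F]cats0 => /parse_plug[G ->].
rewrite cats0 => /(@parse_output (Num Size Start) _ _ isT)[w1 [f [-> H]]] /tsat3_init_inv.
move=> [e1 [e2 [n0 [r0 [Es /H[s [Hr Hok Hf]]]]]]].
rewrite Es in Hr; have [K [-> Hwf Et]] := krun_inv Hr Hok.
by exists K, f; rewrite /enc_MC -Et.
Qed.

Theorem mainTheorem11 : logspace_reducible MC_lang Delta30_lang.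
Proof.
have [L HL] := out_bound.
pose L' := maxn L (size (enc_ctx cInit)).
have Hpre : size (enc_ctx cInit) <= L' by apply: leq_maxr.
have Hout q a : size (out q a) <= L' by apply: leq_trans (HL q a) (leq_maxl _ _).
exists (transducer (Num Size Start) (enc_ctx cInit) nxt out L'); split.
  exact: transducer_logspace.
move=> w o Ho; rewrite MC_outputP.
by rewrite (ltm_computes_fun Ho (transducer_computes (Num Size Start) nxt Hpre Hout w)).
Qed.
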